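(* Let $\eta^*$ be the unique number in the interval $(1,2]$ that satisfies the equation $$\frac{2^{\eta^*}+1}{2^{\eta^*}}\cdot\frac{(3^{\eta^*}+1)^2}{3^{2\eta^*}+1}=\frac{\zeta(\eta^* )}{\zeta(2\eta^* )}.$$ If $r\in\mathbb{R}$, then $\overline{\sigma_{-r}^*(\mathbb{N})}$ is connected if and only if $r\in(0,\eta^*]$.
   Context: $\mathbb{N}$ is the set of positive integers and $\zeta$ is the Riemann zeta function. For real $t$, the unitary divisor function $\sigma_t^*:\mathbb{N}\to\mathbb{R}$ is $\sigma_t^*(n)=\sum_{d\mid n,\ \gcd(d,n/d)=1}d^t$ (sum over positive divisors $d$); equivalently, it is the multiplicative function with $\sigma_t^*(p^\alpha)=1+p^{\alpha t}$ for all primes $p$ and positive integers $\alpha$. $\sigma_t^*(\mathbb{N})$ denotes its range, and the overline denotes topological closure in $\mathbb{R}$. The existence and uniqueness of a solution $\eta^*\in(1,2]$ of the displayed equation is part of what is asserted. *)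

(* Defs.v *)
From mathcomp Require Import all_boot all_order all_algebra.
From mathcomp Require Import all_classical all_reals all_analysis.
Import Order.TTheory GRing.Theory Num.Theory numFieldNormedType.Exports.
Set Implicit Arguments.
Unset Strict Implicit.
Unset Printing Implicit Defensive.
Local Open Scope classical_set_scope.
Local Open Scope ring_scope.

(* Meaningful for 1 < s, where the Dirichlet series converges;
   [riemannR s k] is [1 / (k + 1) `^ s]. *)
Definition zeta (R : realType) (s : R) : R := limn (series (riemannR s)).

Definition unitary_sigma (R : realType) (t : R) (n : nat) : R :=
  \sum_(d <- divisors n | coprime d (n %/ d)) d%:R `^ t.

(* [divisors 0 = [::]], so without [0 < n] the range would contain a spurious 0. *)
Definition unitary_sigma_range (R : realType) (t : R) : set R :=
  [set unitary_sigma t n | n in [set n : nat | (0 < n)%N]].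

Definition eta_star_equation (R : realType) (s : R) : Prop :=
  (2 `^ s + 1) / 2 `^ s * ((3 `^ s + 1) ^+ 2 / (3 `^ (2 * s) + 1))
  = zeta s / zeta (2 * s).

(* Main.v *)
(** For [r <= 0] the value [1] is isolated. For [r > 0] write [x_p = p^-r]: the
    values are the finite products of factors [1 + x_p^a], one for each prime [p]
    dividing [n]. Choose the factors greedily, prime by prime, to stay just below
    a target. At [p] the greedy choice loses at most the factor
    [f(x_p) = (1 + x_p) / (1 + x_p^2)], so every target below the supremum is
    reached in the limit as soon as [f(x_p)] is at most the product of
    [1 + x_q] over the primes [q > p], for every [p]. For [r <= 2] and [p >= 5] this
    holds because the sum of [(p / q)^2] over the primes [q > p] is at least [1]
    (a Chebyshev bound for large [p], explicit primes for small [p]), and the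
    condition at [2] follows from the one at [3]. Conversely, if the condition at
    [3] fails then there is a gap just below [(1 + x_2) (1 + x_3)].

    By the Euler product the condition at [3] compares
    [(1 + x_2) (1 + x_3) f(x_3)] with [zeta r / zeta (2 r)]. Their quotient is
    strictly monotone on [(1, 2]]: the factors at the primes [q >= 11] are monotone
    in [r], and those at 3, 5, 7 are compared by Bernoulli's inequality. The
    condition holds at [5/4], and fails for all [r >= 2]. *)
Require Import Defs.
From mathcomp Require Import all_boot all_order all_algebra zify ring lra.
From mathcomp Require Import all_classical all_reals all_analysis.
Import Order.TTheory GRing.Theory Num.Theory numFieldNormedType.Exports.
Set Implicit Arguments.
Unset Strict Implicit.
Unset Printing Implicit Defensive.

(** * Primes in short intervals *)

(** Induction along [(n + 1) C(2n + 2, n + 1) = 2 (2n + 1) C(2n, n)]. *)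
Lemma expn4_le_central_binomial n : 0 < n -> 4 ^ n <= n.*2 * 'C(n.*2, n).
Proof.
elim: n => // -[|n] IH _ //.
have {}IH := IH isT; move: n.+1 IH => {}n IH.
have E : n.+1 * 'C(n.+1.*2, n.+1) = 2 * (n.*2.+1 * 'C(n.*2, n)).
  rewrite doubleS -(mul_bin_diag n.*2.+2 n) /=.
  have := mul_bin_down n.*2.+1 n; rewrite /= (_ : n.*2.+1 - n = n.+1); last lia.
  by move=> ->; rewrite mulnA; congr (_ * _); lia.
rewrite expnS -[X in _ <= X * _]mul2n -mulnA E mulnA.
apply: (leq_trans (leq_mul (leqnn 4) IH)).
by rewrite !mulnA leq_mul2r; apply/orP; right; lia.
Qed.

(** By Legendre's formula the valuation is the sum over [k] of [n.*2 %/ p^k - 2 (n %/ p^k)]. Each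
    term is 0 or 1, and it vanishes once [p^k > n.*2]. *)
Lemma logn_central_binomial p n : prime p -> logn p 'C(n.*2, n) <= trunc_log p n.*2.
Proof.
move=> pp.
have [->|n0] := posnP n; first by rewrite bin0 logn1.
have E : logn p (n.*2)`! = logn p 'C(n.*2, n) + (logn p n`!).*2.
  have le : n <= n.*2 by lia.
  rewrite -(bin_fact le) -addnn addnK lognM ?muln_gt0 ?fact_gt0 ?bin_gt0 ?addnn //.
  by rewrite lognM ?fact_gt0 // addnn.
have En : logn p n`! = \sum_(1 <= k < n.*2.+1) n %/ p ^ k.
  rewrite logn_fact // (@big_cat_nat _ _ _ n.+1 1 n.*2.+1) //=; last by lia.
  rewrite [X in _ = _ + X]big1_seq ?addn0 // => k;
    rewrite mem_index_iota => /andP[_ /andP[lk _]].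
  by rewrite divn_small // (leq_trans (ltn_expl n (prime_gt1 pp))) // leq_exp2l ?prime_gt1 //;
    lia.
have T : \sum_(1 <= k < n.*2.+1) (p ^ k <= n.*2 : nat) <= trunc_log p n.*2.
  have [tl|/ltnW tl] := leqP n.*2 (trunc_log p n.*2).
    apply: leq_trans tl; rewrite -[X in _ <= X]subn0 -(subSS 0).
    rewrite -(muln1 (_ - _)) -sum_nat_const_nat; apply: leq_sum => k _; exact: leq_b1.
  rewrite (@big_cat_nat _ _ _ (trunc_log p n.*2).+1) //=.
  rewrite [X in _ + X]big1_seq ?addn0; last first.
    move=> k; rewrite mem_index_iota => /andP[_ /andP[lk _]]; apply/eqP; rewrite eqb0 -ltnNge.
    by rewrite (leq_trans (trunc_log_ltn _ (prime_gt1 pp))) // leq_exp2l ?prime_gt1.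
  rewrite -[X in _ <= X]subn0 -(subSS 0).
  by rewrite -(muln1 (_ - _)) -sum_nat_const_nat; apply: leq_sum => k _; exact: leq_b1.
apply: leq_trans T.
suff : logn p (n.*2)`! <= (logn p n`!).*2 + \sum_(1 <= k < n.*2.+1) (p ^ k <= n.*2 : nat) by
  lia.
rewrite En logn_fact // -[X in _ <= X + _]mul2n big_distrr /= -big_split /=;
  apply: leq_sum => k _.
have p0 : 0 < p ^ k by rewrite expn_gt0 prime_gt0.
have := divn_eq n (p ^ k); have := ltn_pmod n p0; set q := n %/ _; set t := n %% _ => lt en.
case: (leqP (p ^ k)) => h /=; last by rewrite divn_small.
rewrite -ltnS ltn_divLR // -addnn en; move: lt; move: (p ^ k) q t {en h p0} => P q t; lia.
Qed.

(** By [logn_central_binomial] every prime power in the factorization is at most [n.*2], and hence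
    so is every prime in it. *)
Lemma central_binomial_le n : 0 < n ->
  'C(n.*2, n) <= n.*2 ^ count prime (iota 0 n.*2.+1).
Proof.
move=> n0; have C0 : 0 < 'C(n.*2, n) by rewrite bin_gt0; lia.
rewrite {1}(prod_prime_decomp C0) prime_decompE big_map /=.
have pb p : p \in primes 'C(n.*2, n) -> p ^ logn p 'C(n.*2, n) <= n.*2.
  rewrite mem_primes => /and3P[pp _ _].
  apply: leq_trans (trunc_logP (prime_gt1 pp) _); last by lia.
  by rewrite leq_exp2l ?prime_gt1 // logn_central_binomial.
apply: (@leq_trans (n.*2 ^ size (primes 'C(n.*2, n)))).
  rewrite -sum1_size (expn_sum (n.*2)) big_seq [X in _ <= X]big_seq.
  by apply: leq_prod => p /pb; rewrite expn1.
rewrite leq_exp2l; last by lia.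
rewrite -size_filter uniq_leq_size ?primes_uniq // => p pC.
rewrite mem_filter mem_iota /= ltnS.
have := pC; rewrite mem_primes => /and3P[pp _ _]; rewrite pp prime_gt0 //=.
apply: leq_trans (pb p pC); rewrite -{1}(expn1 p) leq_exp2l ?prime_gt1 //.
by rewrite logn_gt0.
Qed.

(** With [n = k p] the two bounds on the central binomial give [4^(k p) <= (2 k p)^(c + 1)], where
    [c] counts the primes up to [2 k p]. Since [2 k p < 4^k], comparing exponents yields
    [p <= c + 1]. *)
Lemma chebyshev_lower k p : 2 < k -> 0 < p -> p < 2 ^ k ->
  p <= (count prime (iota 0 (2 * k * p).+1)).+1.
Proof.
move=> k2 p0 pk.
have kp0 : 0 < k * p by rewrite muln_gt0 p0; lia.
have Nlt : 2 * k * p < 2 ^ (2 * k).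
  have k2k : 2 * k <= 2 ^ k.
    elim: k k2 {pk kp0} => // k IH; rewrite ltnS leq_eqVlt => /predU1P[<- //|k2].
    by rewrite expnS mulnS; have := IH k2; move: (2 ^ k) => m; lia.
  apply: (@leq_ltn_trans (2 ^ k * p)); first by rewrite leq_mul2r k2k orbT.
  by rewrite [X in _ < 2 ^ X]mul2n -addnn expnD ltn_mul2l pk expn_gt0.
have h := expn4_le_central_binomial kp0.
have := leq_trans h (leq_mul (leqnn _) (central_binomial_le kp0)).
rewrite -mul2n mulnA -expnS -(expnM 2 2) => {}h.
set c := count _ _ in h *.
have {}h : 2 ^ (2 * (k * p)) <= 2 ^ (2 * k * c.+1).
  apply: leq_trans h _; rewrite [X in _ <= X]expnM leq_exp2r //.
  exact: ltnW.
rewrite leq_exp2l // mulnA leq_pmul2l // in h; lia.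
Qed.

(** Induction in steps of two: of two consecutive integers above 2 one is even, hence not prime. *)
Lemma count_prime_le n : (count prime (iota 0 n.+1)).*2 <= n.+1.
Proof.
elim/ltn_ind: n => -[|[|[|[|n]]]] // IH.
have := IH n.+2 (leqnSn _).
rewrite -(addn2 n.+3) iotaD count_cat add0n.
suff : count prime (iota n.+3 2) <= 1 by lia.
rewrite /= addn0.
have H m : 2 < m -> ~~ odd m -> prime m = false.
  move=> m2 om; apply/negP => /even_prime[m2E|odd_m]; first by rewrite m2E in m2.
  by rewrite odd_m in om.
have [odd3|even3] := boolP (odd n.+3); last by rewrite H //; exact: leq_b1.
by rewrite (H n.+4) ?addn0 ?leq_b1 //=; move: odd3 => /= ->.
Qed.

(* [p <= pi(2 k p) + 1] with [2^(k-1) <= p < 2^k], while [pi(p)] is at most about [p / 2]. *)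
Lemma count_primes_above p : 2 ^ 10 <= p -> exists2 k, 0 < k &
  4 * k ^ 2 <= count prime (iota p.+1 (2 * k * p - p)).
Proof.
move=> p10.
have [k /andP[kp pk]] : exists k, 2 ^ k <= p < 2 ^ k.+1.
  by exists (trunc_log 2 p); apply: trunc_log_bounds => //; apply: leq_trans p10.
have k10 : 10 <= k.
  by rewrite -ltnS -(ltn_exp2l _ _ (isT : 1 < 2)) (leq_ltn_trans p10).
exists k.+1 => //.
have p0 : 0 < p by apply: leq_trans p10.
have h1 := @chebyshev_lower k.+1 p ltac:(lia) p0 pk.
have h2 := count_prime_le p.
have eN : (2 * k.+1 * p).+1 = p.+1 + (2 * k.+1 * p - p).
  by rewrite addSn subnKC // -{1}(mul1n p) leq_mul2r; lia.
move: h1; rewrite eN iotaD count_cat add0n; set c := count _ (iota p.+1 _) => h3.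
(* At least [p - 1 - (p + 1) / 2] primes remain above [p], and [p >= 2^k]. At [k = 10] the
   inequality reads [972 <= 1024], whence the threshold [2^10]. *)
suff : 8 * k.+1 ^ 2 + 4 <= 2 ^ k.
  by move: (count _ _) (k.+1 ^ 2) (2 ^ k) h2 h3 kp {eN pk k10} => a b d; lia.
elim: k k10 {kp pk h3 c p10 eN} => // k IH; rewrite ltnS leq_eqVlt => /predU1P[<- //|k10].
have := IH k10; rewrite (expnS 2); move: (2 ^ k) => m; rewrite -!mulnn; nia.
Qed.

Local Open Scope classical_set_scope.
Local Open Scope ring_scope.

(** Lets an explicit increasing list of primes certify a lower bound. *)
Lemma sum_primes_ge (R : realFieldType) (F : nat -> R) a M (s : seq nat) :
  (forall q, 0 <= F q) -> path ltn a s -> all prime s -> all (ltn^~ M) s ->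
  \sum_(q <- s) F q <= \sum_(a.+1 <= q < M | prime q) F q.
Proof.
move=> F0; elim: s a => [|x s IH] a; first by rewrite big_nil sumr_ge0.
move=> /= /andP[ax xs] /andP[xp sp] /andP[xM sM].
rewrite (big_cat_nat (n := x)) ?(ltnW xM) //= big_cons.
rewrite (big_ltn_cond xM) xp -[leLHS]add0r.
by apply: lerD; [exact: sumr_ge0|rewrite lerD2l IH].
Qed.

Lemma prime_square_tail (R : realFieldType) p : prime p -> (5 <= p)%N ->
  exists M, 1 <= \sum_(p.+1 <= q < M | prime q) (p%:R / q%:R) ^+ 2 :> R.
Proof.
move=> pp p5; have p0 : (0 < p)%N by exact: prime_gt0.
pose F (q : nat) : R := (p%:R / q%:R) ^+ 2.
have F0 q : 0 <= F q by exact: sqr_ge0.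
have from_list s M : path ltn p s -> all prime s -> all (ltn^~ M) s ->
    1 <= \sum_(q <- s) F q -> exists M, 1 <= \sum_(p.+1 <= q < M | prime q) F q.
  by move=> h1 h2 h3 h4; exists M; apply: le_trans h4 _; exact: sum_primes_ge.
have four a (q1 q2 q3 q4 : nat) : all prime [:: q1; q2; q3; q4] ->
    [&& q1 < q2, q2 < q3, q3 < q4 & q4 <= a.*2]%N -> (a <= p)%N -> (p < q1)%N ->
    exists M, 1 <= \sum_(p.+1 <= q < M | prime q) F q.
  move=> pq /and4P[h2 h3 h4 h5'] ap h1.
  have h5 : (q4 <= p.*2)%N by rewrite (leq_trans h5') // leq_double.
  apply: (@from_list [:: q1; q2; q3; q4] q4.+1) => //; first by rewrite /= h1 h2 h3 h4.
    by rewrite /=; lia.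
  have Fq q : (p < q <= p.*2)%N -> 4^-1 <= F q.
    move=> /andP[pq1 q2p]; rewrite /F expr_div_n ler_pdivlMr; last first.
      by rewrite exprn_gt0 // ltr0n; lia.
    rewrite mulrC ler_pdivrMr // -!natrX -natrM ler_nat; move: q2p; rewrite -!mulnn -addnn; nia.
  rewrite !big_cons big_nil.
  have := Fq q1 ltac:(lia); have := Fq q2 ltac:(lia).
  have := Fq q3 ltac:(lia); have := Fq q4 ltac:(lia). lra.
(* Four primes in [(p, 2 p]] suffice up to [2^10]. *)
have [pbig|psmall] := leqP (2 ^ 10) p.
  (* At least [4 k^2] primes lie in [(p, 2 k p]], and each contributes at least [1 / (2 k)^2]. *)
  have [k k0 hk] := count_primes_above pbig.
  exists (p.+1 + (2 * k * p - p))%N; set N := (_ + _)%N.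
  have eN : N = (2 * k * p).+1.
    by rewrite /N addSn subnKC // -{1}(mul1n p) leq_mul2r; lia.
  apply: (@le_trans _ _ (\sum_(p.+1 <= q < N | prime q) ((2 * k)%:R^-1) ^+ 2)); last first.
    rewrite big_nat_cond [leRHS]big_nat_cond; apply: ler_sum => q /andP[/andP[pq qN] _].
    rewrite ler_sqr ?nnegrE ?invr_ge0 ?divr_ge0 //.
    rewrite ler_pdivlMr ?ltr0n; last by lia.
    rewrite ler_pdivrMl ?ltr0n; last by lia.
    rewrite -natrM ler_nat; lia.
  rewrite big_const_seq iter_addr_0 -[_ *+ count _ _]mulr_natr exprVn ler_pdivlMl.
    rewrite mulr1 -natrX ler_nat /index_iota (_ : N - p.+1 = 2 * k * p - p)%N;
      last by rewrite /N addKn.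
    by apply: leq_trans hk; rewrite expnMn.
  by rewrite exprn_gt0 // ltr0n; lia.
(* For 5, 7, 11 and 13 fewer than four primes lie in [(p, 2 p]], so each gets its own list. *)
have [p17|p17] := leqP 17 p; last first.
  have : p \in [:: 5; 7; 11; 13]%N.
    have : p \in [seq q <- iota 5 12 | prime q] by rewrite mem_filter pp mem_iota; lia.
    by [].
  rewrite !inE => /or4P[] /eqP e; subst p.
  - by apply: (@from_list [:: 7; 11; 13; 17; 19; 23]%N 24) => //;
    rewrite /F !big_cons big_nil; lra.
  - by apply: (@from_list [:: 11; 13; 17; 19; 23]%N 24) => //; rewrite /F !big_cons big_nil;
    lra.
  - by apply: (@from_list [:: 13; 17]%N 18) => //; rewrite /F !big_cons big_nil; lra.
  - by apply: (@from_list [:: 17; 19]%N 20) => //; rewrite /F !big_cons big_nil; lra.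
(* A call with [a], [q1], ..., [q4] covers [a <= p < q1]: since [q4 <= 2 a], the four primes lie in
   [(p, 2 p]]. *)
have [h|{}p17] := ltnP p 19; first exact: (@four 17 19 23 29 31 isT isT p17 h).
have [h|{}p17] := ltnP p 23; first exact: (@four 19 23 29 31 37 isT isT p17 h).
have [h|{}p17] := ltnP p 31; first exact: (@four 23 31 37 41 43 isT isT p17 h).
have [h|{}p17] := ltnP p 47; first exact: (@four 31 47 53 59 61 isT isT p17 h).
have [h|{}p17] := ltnP p 73; first exact: (@four 47 73 79 83 89 isT isT p17 h).
have [h|{}p17] := ltnP p 127; first exact: (@four 73 127 131 137 139 isT isT p17 h).
have [h|{}p17] := ltnP p 233; first exact: (@four 127 233 239 241 251 isT isT p17 h).
have [h|{}p17] := ltnP p 449; first exact: (@four 233 449 457 461 463 isT isT p17 h).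
have [h|{}p17] := ltnP p 877; first exact: (@four 449 877 881 883 887 isT isT p17 h).
exact: (@four 877 1733 1741 1747 1753 isT isT p17 (leq_trans psmall (isT : 2 ^ 10 <= 1733)%N)).
Qed.

(** * The unitary divisor function as a product *)

Lemma unitary_sigma1 (R : realType) (t : R) : unitary_sigma t 1 = 1.
Proof. by rewrite /unitary_sigma big_cons big_nil /= powR1 addr0. Qed.

Definition unitary_divisors n := [seq d <- divisors n | coprime d (n %/ d)].

(** Since [p] cannot divide both a unitary divisor and its codivisor, the divisor either avoids [p]
    or takes the whole of [p^a]. *)
Lemma perm_unitary_divisors p a m : prime p -> (0 < a)%N -> (0 < m)%N -> ~~ (p %| m)%N ->
  perm_eq (unitary_divisors (p ^ a * m))
    (unitary_divisors m ++ [seq (p ^ a * d)%N | d <- unitary_divisors m]).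
Proof.
move=> pp a0 m0 pm; set U := unitary_divisors; set q := (p ^ a)%N.
have q0 : (0 < q)%N by rewrite expn_gt0 prime_gt0.
have cop n : coprime q n = ~~ (p %| n)%N by rewrite coprime_pexpl // prime_coprime.
have memU n d : (0 < n)%N -> (d \in U n) = coprime d (n %/ d) && (d %| n)%N.
  by move=> n0; rewrite mem_filter -dvdn_divisors.
have uU n : uniq (U n) by rewrite filter_uniq // divisors_uniq.
have q_dvd_p n : (p %| q * n)%N by rewrite dvdn_mulr // -{1}(expn1 p) dvdn_exp2l.
apply: uniq_perm => //.
  rewrite cat_uniq uU map_inj_uniq ?uU ?andbT /=; last first.
    by move=> x y /eqP; rewrite eqn_pmul2l // => /eqP.
  apply/hasPn => _ /mapP[e _ ->]; rewrite memU // negb_and; apply/orP; right.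
  by apply: contra pm; apply: dvdn_trans.
move=> d; rewrite memU ?muln_gt0 ?q0 // mem_cat memU //.
apply/idP/orP => [/andP[cd dqm]|[/andP[cd dm]|/mapP[e]]].
- have [pd|pd] := boolP (p %| d)%N; last first.
    left; have dm : (d %| m)%N by rewrite -(@Gauss_dvdr d q) // coprime_sym cop.
    by rewrite dm andbT; move: cd; rewrite -muln_divA // coprimeMr => /andP[].
  right; have e := divnK dqm; set c := (_ %/ d)%N in cd e.
  have pc : ~~ (p %| c)%N.
    have d0 := @coprime_dvdl _ _ c pd cd.
    by rewrite -prime_coprime.
  have qd : (q %| d)%N by rewrite -(@Gauss_dvdr q c) ?cop // e dvdn_mulr.
  have ed := divnK qd; set x := (d %/ q)%N in ed.
  apply/mapP; exists x; last by rewrite -ed mulnC.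
  have xc : (x * c = m)%N.
    by apply/eqP; rewrite -(eqn_pmul2l q0) mulnA (mulnC q) ed mulnC e.
  have x0 : (0 < x)%N by move: m0; rewrite -xc muln_gt0 => /andP[].
  rewrite memU // -xc mulKn // dvdn_mulr // andbT.
  by move: cd; rewrite -ed coprimeMl => /andP[].
- rewrite -muln_divA // dvdn_mull // andbT coprimeMr cd andbT coprime_sym cop.
  by apply: contra pm => pd; apply: dvdn_trans dm.
- rewrite memU // => /andP[ce em] ->; rewrite divnMl // dvdn_pmul2l // em andbT.
  rewrite coprimeMl ce andbT cop; apply: contra pm => pd.
  by apply: dvdn_trans pd _; apply/dvdnP; exists e; rewrite mulnC divnK.
Qed.

Lemma unitary_sigma_mul (R : realType) (t : R) p a m :
  prime p -> (0 < a)%N -> (0 < m)%N -> ~~ (p %| m)%N ->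
  unitary_sigma t (p ^ a * m) = (1 + (p ^ a)%:R `^ t) * unitary_sigma t m.
Proof.
move=> pp a0 m0 pm; rewrite /unitary_sigma -big_filter -/(unitary_divisors _).
rewrite (perm_big _ (perm_unitary_divisors pp a0 m0 pm)) /= big_cat big_map /=.
rewrite mulrDl mul1r big_filter mulr_sumr big_filter; congr (_ + _).
by apply: eq_bigr => d _; rewrite natrM powRM.
Qed.

(** Without the case split a prime not dividing [n] would contribute [1 + 1] instead of [1]. *)
Definition local_factor (R : realType) (t : R) (p n : nat) : R :=
  if (p %| n)%N then 1 + (p ^ logn p n)%:R `^ t else 1.

(** Induction on the bound: if the top prime [b] divides [n], its full power is split off by
    [unitary_sigma_mul]. *)
Lemma unitary_sigma_prod (R : realType) (t : R) b n : (0 < n)%N ->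
  (forall p, prime p -> (p %| n)%N -> (p < b)%N) ->
  unitary_sigma t n = \prod_(0 <= p < b | prime p) local_factor t p n.
Proof.
elim: b n => [|b IH] n n0 nb.
  rewrite big_geq // (_ : n = 1%N) ?unitary_sigma1 //.
  have [//|n1] := leqP n 1; first by move=> ?; apply/eqP; rewrite eqn_leq n0 andbT.
  by have := nb _ (pdiv_prime n1) (pdiv_dvd n).
rewrite big_mkcond big_nat_recr //= -big_mkcond /=.
have [/andP[pb bn]|nbn] := boolP (prime b && (b %| n)%N); last first.
  rewrite -IH // => [|p pp pn].
    move: nbn; rewrite negb_and /local_factor => /orP[/negbTE ->|/negbTE ->];
      first by rewrite mulr1.
    by case: ifP; rewrite mulr1.
  have := nb p pp pn; rewrite ltnS leq_eqVlt => /predU1P[e|//].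
  by move: nbn; rewrite -e pp pn.
have [m bm en] := pfactor_coprime pb n0.
rewrite /local_factor bn pb mulrC; set a := logn b n in en *.
have m0 : (0 < m)%N by move: n0; rewrite en muln_gt0 => /andP[].
have a0 : (0 < a)%N by rewrite logn_gt0 mem_primes pb n0.
rewrite {1}en mulnC unitary_sigma_mul -?prime_coprime //; congr (_ * _).
have dvd p : prime p -> p != b -> (p %| n)%N = (p %| m)%N.
  move=> pp pb'; rewrite en Euclid_dvdM // orbC Euclid_dvdX // dvdn_prime2 //.
  by rewrite (negbTE pb').
rewrite IH // => [|p pp pm].
  rewrite big_nat_cond [RHS]big_nat_cond; apply: eq_bigr => p /andP[/= pltb pp].
  have pb' : p != b by rewrite neq_ltn pltb.
  rewrite /local_factor dvd //; case: ifP => // _.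
  rewrite en lognM ?expn_gt0 ?(prime_gt0 pb) // lognX (_ : logn p b = 0%N) ?muln0 ?addn0 //.
  by apply/eqP; rewrite -leqn0 leqNgt logn_gt0 mem_primes dvdn_prime2 // (negbTE pb') !andbF.
have pb' : p != b by apply: contraTneq pm => ->; rewrite -prime_coprime.
by have := nb p pp; rewrite dvd // ltnS leq_eqVlt (negbTE pb') => /(_ pm).
Qed.

(** The unitary divisors [1] and [n] are distinct, and each contributes at least 1. *)
Lemma unitary_sigma_ge2 (R : realType) (t : R) n : 0 <= t -> (1 < n)%N ->
  2 <= unitary_sigma t n.
Proof.
move=> t0 n1; have n0 := ltnW n1.
have E : perm_eq (divisors n) (1%N :: n :: rem n (rem 1%N (divisors n))).
  have h1 : 1%N \in divisors n by rewrite -dvdn_divisors ?dvd1n.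
  rewrite (permPl (perm_to_rem h1)) perm_cons perm_to_rem // mem_rem_uniq ?divisors_uniq //.
  by rewrite inE -dvdn_divisors // dvdnn andbT /= gtn_eqF.
rewrite /unitary_sigma (perm_big _ E) !big_cons coprime1n divnn n0 coprimen1 powR1 /=.
have n1' : 1 <= n%:R `^ t :> R by rewrite -{1}(powRr0 n%:R) ler_powR // ler1n.
suff : 0 <= \sum_(d <- rem n (rem 1%N (divisors n)) | coprime d (n %/ d)) d%:R `^ t :> R by lra.
by apply: sumr_ge0 => *; exact: powR_ge0.
Qed.

(** * Greedy approximation *)

Lemma exprn_small (R : realType) (q d : R) : 0 <= q < 1 -> 0 < d -> exists n, q ^+ n < d.
Proof.
move=> /andP[q0 q1] d0.
have /cvgrPdist_lt/(_ _ d0) := @cvg_expr R q ltac:(by rewrite ger0_norm).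
case=> N _ /(_ N (leqnn N)) /=; rewrite sub0r normrN ger0_norm ?exprn_ge0 // => h.
by exists N.
Qed.

Section PrimeProduct.
Variables (R : realType) (r : R).
Hypothesis r_gt0 : 0 < r.

(** The value at the product of the primes in [[a, b)], which is also the most that these primes can
    contribute to any value. *)
Definition prime_prod a b : R := \prod_(a <= q < b | prime q) (1 + q%:R `^ (- r)).

Lemma natpow_gt0 q : (0 < q)%N -> 0 < q%:R `^ (- r) :> R.
Proof. by move=> q0; rewrite powR_gt0 // ltr0n. Qed.

Lemma natpow_lt1 q : (1 < q)%N -> q%:R `^ (- r) < 1 :> R.
Proof.
move=> q1; rewrite powRN invf_lt1 ?powR_gt0 ?ltr0n ?(ltnW q1) //.
have e : 1 `^ r = 1 :> R by rewrite powR1.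
rewrite -[ltLHS]e.
by apply: gt0_ltr_powR; rewrite // ?nnegrE ?ler0n ?ltr1n ?ler01.
Qed.

Lemma natpowX q a : (q ^ a)%:R `^ (- r) = (q%:R `^ (- r)) ^+ a :> R.
Proof. by rewrite natrX -powR_mulrn ?ler0n // powRAC powR_mulrn ?powR_ge0. Qed.

Lemma prime_prod_ge1 a b : 1 <= prime_prod a b.
Proof.
rewrite /prime_prod; elim/big_ind: _ => // [x y x1 y1|q _]; first by rewrite mulr_ege1.
by rewrite lerDl powR_ge0.
Qed.

Lemma prime_prod_cat a b c : (a <= b <= c)%N ->
  prime_prod a c = prime_prod a b * prime_prod b c.
Proof. by move=> /andP[ab bc]; rewrite /prime_prod (big_cat_nat ab bc). Qed.

Lemma prime_prod_le a b c : (b <= c)%N -> prime_prod a b <= prime_prod a c.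
Proof.
move=> bc; have [ab|/ltnW ba] := leqP a b; last first.
  by rewrite {1}/prime_prod big_geq ?prime_prod_ge1.
rewrite (prime_prod_cat (b := b) (c := c)) ?ab // ler_peMr ?prime_prod_ge1 //.
by rewrite (le_trans ler01) ?prime_prod_ge1.
Qed.

Lemma prime_prodS a b : (a <= b)%N ->
  prime_prod a b.+1 = prime_prod a b * (if prime b then 1 + b%:R `^ (- r) else 1).
Proof. by move=> ab; rewrite /prime_prod big_mkcond big_nat_recr //= -big_mkcond. Qed.

Lemma prime_prodSl a b : (a < b)%N ->
  prime_prod a b = (if prime a then 1 + a%:R `^ (- r) else 1) * prime_prod a.+1 b.
Proof. by move=> ab; rewrite /prime_prod big_mkcond big_ltn //= -big_mkcond. Qed.

Lemma local_factor_ge1 p n : 1 <= local_factor (- r) p n.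
Proof. by rewrite /local_factor; case: ifP => // _; rewrite lerDl powR_ge0. Qed.

Lemma local_factorE p n : local_factor (- r) p n =
  if (p %| n)%N then 1 + (p%:R `^ (- r)) ^+ logn p n else 1.
Proof. by rewrite /local_factor natpowX. Qed.

Lemma local_factor_le p n : prime p -> (0 < n)%N ->
  local_factor (- r) p n <= 1 + p%:R `^ (- r).
Proof.
move=> pp n0; rewrite local_factorE; case: ifP => [pn|_]; last by rewrite lerDl powR_ge0.
rewrite lerD2l -[leRHS]expr1 ler_wiXn2l ?powR_ge0 ?(ltW (natpow_lt1 (prime_gt1 pp))) //.
by rewrite logn_gt0 mem_primes pp n0.
Qed.

Lemma local_factor_le2 p n : prime p -> (0 < n)%N -> logn p n != 1%N ->
  local_factor (- r) p n <= 1 + (p%:R `^ (- r)) ^+ 2.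
Proof.
move=> pp n0 l1; rewrite local_factorE; case: ifP => [pn|_]; last by rewrite lerDl sqr_ge0.
rewrite lerD2l ler_wiXn2l ?powR_ge0 ?(ltW (natpow_lt1 (prime_gt1 pp))) //.
by rewrite ltn_neqAle eq_sym l1 logn_gt0 mem_primes pp n0.
Qed.

Lemma local_factors_bounds a b n : (0 < n)%N ->
  1 <= \prod_(a <= p < b | prime p) local_factor (- r) p n <= prime_prod a b.
Proof.
move=> n0; apply/andP; split.
  elim/big_ind: _ => // [x y x1 y1|q _]; [by rewrite mulr_ege1|exact: local_factor_ge1].
apply: ler_prod => p pp; rewrite local_factor_le // andbT.
by rewrite (le_trans ler01) ?local_factor_ge1.
Qed.

Definition smooth k n := forall p, prime p -> (p %| n)%N -> (p < k)%N.

Lemma smoothS n : (0 < n)%N -> smooth n.+1 n.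
Proof. by move=> n0 p _ pn; rewrite ltnS dvdn_leq. Qed.

Lemma smooth_le k l n : (k <= l)%N -> smooth k n -> smooth l n.
Proof. by move=> kl sn p pp pn; apply: leq_trans kl; exact: sn. Qed.

Lemma unitary_sigma_bounds k n : (0 < n)%N -> smooth k n ->
  1 <= unitary_sigma (- r) n <= prime_prod 0 k.
Proof. by move=> n0 sn; rewrite (unitary_sigma_prod _ n0 sn) local_factors_bounds. Qed.

Lemma unitary_sigma_ge1 n : (0 < n)%N -> 1 <= unitary_sigma (- r) n.
Proof. by move=> n0; case/andP: (unitary_sigma_bounds n0 (smoothS n0)). Qed.

Lemma smooth_mul k a n : prime k -> (0 < a)%N -> (0 < n)%N -> smooth k n ->
  [/\ (0 < k ^ a * n)%N, smooth k.+1 (k ^ a * n) &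
     unitary_sigma (- r) (k ^ a * n) = (1 + (k%:R `^ (- r)) ^+ a) * unitary_sigma (- r) n].
Proof.
move=> kp a0 n0 sn; split; first by rewrite muln_gt0 expn_gt0 prime_gt0.
  move=> p pp; rewrite Euclid_dvdM // Euclid_dvdX // dvdn_prime2 // ltnS.
  by case/orP => [/andP[/eqP -> _]|/(sn _ pp)/ltnW].
rewrite unitary_sigma_mul // ?natpowX //.
by apply/negP => /(sn _ kp); rewrite ltnn.
Qed.

(** Multiply [n] by every prime in [[k, l)]. *)
Lemma unitary_sigma_extend k l n : (k <= l)%N -> (0 < n)%N -> smooth k n ->
  exists m, [/\ (0 < m)%N, smooth l m &
    unitary_sigma (- r) m = unitary_sigma (- r) n * prime_prod k l].
Proof.
move=> kl n0 sn; elim: l kl => [|l IH].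
  by rewrite leqn0 => /eqP k0; subst k; exists n; rewrite /prime_prod big_geq // mulr1.
rewrite leq_eqVlt => /predU1P[<-|kl].
  by exists n; rewrite /prime_prod big_geq // mulr1.
have [m [m0 sm em]] := IH kl; rewrite prime_prodS //.
have [lp|_] := boolP (prime l); last first.
  by exists m; split=> //; [exact: smooth_le sm|rewrite mulr1].
have [h1 h2 h3] := smooth_mul lp (isT : 0 < 1)%N m0 sm.
by exists (l ^ 1 * m)%N; split=> //; rewrite h3 em expr1; ring.
Qed.

Definition gap_ratio (y : R) : R := (1 + y) / (1 + y ^+ 2).

(** Among the ratios of consecutive local factors the first, [(1 + y) / (1 + y^2)], is the largest:
    with [z = y^a] the cross-multiplied difference is [y (1 - y) (1 - z)]. *)
Lemma gap_ratio_pow (y : R) a : 0 <= y <= 1 -> 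
  (1 + y ^+ a.+1) <= gap_ratio y * (1 + y ^+ a.+2).
Proof.
move=> /andP[y0 y1]; rewrite /gap_ratio mulrAC ler_pdivlMr; last first.
  by rewrite ltr_wpDr ?sqr_ge0.
have ya : 0 <= y ^+ a <= 1 by rewrite exprn_ge0 ?exprn_ile1.
rewrite !exprS; move: (y ^+ a) ya => z /andP[z0 z1]; rewrite expr0 mulr1.
have : 0 <= y * (1 - y) * (1 - z) by rewrite !mulr_ge0 // subr_ge0.
nra.
Qed.

(* That is, [gap_ratio (p^-r)] is at most the infinite product over the primes above [p],
   which may diverge; at [p = 3] and [r = eta] the two are equal. *)
Hypothesis greedy : forall p, prime p -> forall e : R, 0 < e ->
  exists M, gap_ratio (p%:R `^ (- r)) < (1 + e) * prime_prod p.+1 M.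

(** The greedy choice after all primes below [k]. The invariant is that the value does not exceed
    [x], while [x] is at most that value times the supremum of the products over the primes from [k]
    on; the factor [1 + e] states this without an infinite product. *)
Lemma greedy_approx x M0 k : 1 <= x -> x < prime_prod 0 M0 ->
  exists n, [/\ (0 < n)%N, smooth k n, unitary_sigma (- r) n <= x &
    forall e : R, 0 < e -> exists M, x < (1 + e) * (unitary_sigma (- r) n * prime_prod k M)].
Proof.
move=> x1 xM; elim: k => [|k [n [n0 sn nx xn]]].
  exists 1%N; rewrite unitary_sigma1; split=> //.
    by move=> p pp; rewrite dvdn1 => /eqP p1; rewrite p1 in pp.
  move=> e e0; exists M0; apply: lt_le_trans xM _; rewrite mul1r ler_peMl //.
    by rewrite (le_trans ler01) ?prime_prod_ge1.
  by rewrite lerDl ltW.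
set s := unitary_sigma _ n in nx xn.
have s1 : 1 <= s := unitary_sigma_ge1 n0.
have s0 : 0 < s := lt_le_trans ltr01 s1.
have x0 : 0 < x := lt_le_trans ltr01 x1.
have [kp|knp] := boolP (prime k); last first.
  exists n; split=> //; first exact: smooth_le sn.
  move=> e e0; have [M hM] := xn e e0; exists (maxn k.+1 M).
  apply: lt_le_trans hM _; rewrite ler_pM2l ?addr_gt0 // ler_pM2l //.
  apply: le_trans (prime_prod_le k (leq_maxr k.+1 M)) _.
  by rewrite prime_prodSl ?leq_maxl // (negbTE knp) mul1r.
set y := k%:R `^ (- r) : R.
have y0 : 0 < y := natpow_gt0 (prime_gt0 kp).
have y1 : y < 1 := natpow_lt1 (prime_gt1 kp).
have [le1|gt1] := lerP ((1 + y) * s) x.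
  have [h1 h2 h3] := smooth_mul kp (isT : 0 < 1)%N n0 sn.
  exists (k ^ 1 * n)%N; rewrite h3 expr1; split=> //.
  move=> e e0; have [M hM] := xn e e0; exists (maxn k.+1 M).
  apply: lt_le_trans hM _; rewrite ler_pM2l ?addr_gt0 // -[leRHS]mulrA mulrCA ler_pM2l //.
  apply: le_trans (prime_prod_le k (leq_maxr k.+1 M)) _.
  by rewrite prime_prodSl ?leq_maxl // kp.
(* If [x] is already attained, no prime is added and the empty product serves for every [e]. *)
have [xs|sx] := eqVneq x s.
  exists n; rewrite -/s -xs; split=> //; first exact: smooth_le sn.
  move=> e e0; exists 0%N; rewrite -{1}[x]mul1r.
  apply: (@lt_le_trans _ _ ((1 + e) * x)); first by rewrite ltr_pM2r // ltrDl.
  by rewrite ler_pM2l ?addr_gt0 // ler_peMr ?prime_prod_ge1 // ltW.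
have {}sx : s < x by rewrite lt_neqAle eq_sym sx.
have ex_a : exists a, (1 + y ^+ a) * s <= x.
  have d0 : 0 < x / s - 1 by rewrite subr_gt0 ltr_pdivlMr // mul1r.
  have [|N hN] := @exprn_small _ y _ _ d0; first by rewrite ltW.
  exists N; rewrite -ler_pdivlMr //; lra.
(* The least exponent that fits is at least 2, so the previous one overshoots [x]; [gap_ratio_pow]
   and [greedy] then restore the invariant. *)
have [a ha amin] := ex_minnP ex_a.
have a1 : (1 < a)%N.
  rewrite ltnNge; apply/negP => a1; suff : (1 + y) * s <= x by rewrite leNgt gt1.
  apply: le_trans ha; rewrite ler_pM2r // lerD2l -[leLHS]expr1.
  by apply: ler_wiXn2l => //; exact: ltW.
case: a a1 ha amin => [|[|a]] // _ ha amin.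
have xa : x < (1 + y ^+ a.+1) * s.
  by rewrite ltNge; apply/negP => /amin; rewrite ltnn.
have [h1 h2 h3] := smooth_mul kp (isT : 0 < a.+2)%N n0 sn.
exists (k ^ a.+2 * n)%N; rewrite h3; split=> // e e0.
have [M hM] := greedy kp e0; exists M.
apply: lt_le_trans xa _.
apply: (@le_trans _ _ (gap_ratio y * (1 + y ^+ a.+2) * s)).
  by rewrite ler_pM2r // gap_ratio_pow // !ltW.
rewrite -/s -mulrA [leRHS]mulrCA [leRHS]mulrC.
by rewrite ler_pM2r ?mulr_gt0 // ?addr_gt0 ?exprn_gt0 // -/y ltW.
Qed.

Lemma closure_ballP (A : set R) x :
  closure A x <-> forall e : R, 0 < e -> exists2 y, A y & `|x - y| < e.
Proof.
split=> [cx e e0|h B /nbhs_ballP[e /= e0 eB]].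
  by have [y [Ay xy]] := cx _ (nbhsx_ballx x e e0); exists y.
by have [y Ay xy] := h e e0; exists y; split=> //; exact: eB.
Qed.

(** Choose greedily up to a [k] beyond which every factor is below [1 + u], then multiply by all
    further primes in turn. Either these products never pass [x], and the invariant brings one
    within the factor [1 + u], or they pass it, and the last one before does. *)
Lemma greedy_closure x M0 : 1 <= x -> x < prime_prod 0 M0 ->
  closure (unitary_sigma_range (- r)) x.
Proof.
move=> x1 xM; apply/closure_ballP => d d0.
have x0 : 0 < x := lt_le_trans ltr01 x1.
pose u := d / (x + d).
have xd : 0 < x + d by rewrite addr_gt0.
have u0 : 0 < u by rewrite divr_gt0.
have ud : u * x < d by rewrite /u mulrAC ltr_pdivrMr // ltr_pM2l // ltrDl.
have [k k0 ku] : exists2 k, (0 < k)%N & forall q, (k <= q)%N -> q%:R `^ (- r) < u.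
  have v0 : 0 < u^-1 `^ r^-1 by rewrite powR_gt0 ?invr_gt0.
  exists (Num.truncn (u^-1 `^ r^-1)).+1 => // q kq.
  have q1 : u^-1 `^ r^-1 < q%:R.
    by apply: lt_le_trans (truncnS_gt _) _; rewrite ler_nat.
  have q0 : 0 < q%:R :> R by apply: lt_trans q1.
  rewrite powRN invf_plt ?posrE ?powR_gt0 //.
  have -> : u^-1 = (u^-1 `^ r^-1) `^ r.
    by rewrite -powRrM mulVf ?gt_eqF // powRr1 // invr_ge0 ltW.
  by apply: gt0_ltr_powR; rewrite // nnegrE ltW.
have [n [n0 sn nx xn]] := greedy_approx k x1 xM.
set s := unitary_sigma _ n in nx xn.
have s1 : 1 <= s := unitary_sigma_ge1 n0.
have s0 : 0 < s := lt_le_trans ltr01 s1.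
(* If no product passes [x], the invariant with [e = u] supplies one that is close enough. *)
have [[M hM]|hno] := pselect (exists M, x < s * prime_prod k M); last first.
  have [M hM] := xn u u0.
  have kM : (k <= maxn k M)%N by exact: leq_maxl.
  have [m [m0 _ em]] := unitary_sigma_extend kM n0 sn.
  exists (unitary_sigma (- r) m); first by exists m.
  have le_x : unitary_sigma (- r) m <= x.
    by rewrite em leNgt; apply/negP => h; apply: hno; exists (maxn k M).
  rewrite ger0_norm ?subr_ge0 // ltrBlDr.
  have : s * prime_prod k M <= unitary_sigma (- r) m.
    by rewrite em ler_pM2l // prime_prod_le // leq_maxr.
  have : u * unitary_sigma (- r) m <= u * x by rewrite ler_pM2l.
  have : (1 + u) * (s * prime_prod k M) <= (1 + u) * unitary_sigma (- r) m.
    by rewrite ler_pM2l ?addr_gt0 // em ler_pM2l // prime_prod_le // leq_maxr.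
  lra.
have exM : exists M, x < s * prime_prod k M by exists M.
(* At the first [N] that passes [x], the product stopped just before is at most [x], and the one
   factor still missing is below [1 + u]. *)
have [N hN Nmin] := ex_minnP exM.
have kN : (k < N)%N.
  rewrite ltnNge; apply/negP => Nk.
  by move: hN; rewrite /prime_prod big_geq // mulr1 ltNge nx.
case: N kN hN Nmin => // N kN hN Nmin.
have le_x : s * prime_prod k N <= x.
  by rewrite leNgt; apply/negP => /Nmin; rewrite ltnn.
have [m [m0 _ em]] := unitary_sigma_extend (kN : (k <= N)%N) n0 sn.
exists (unitary_sigma (- r) m); first by exists m.
rewrite em -/s ger0_norm ?subr_ge0 // ltrBlDr.
move: hN; rewrite prime_prodS // mulrA.
have : u * (s * prime_prod k N) <= u * x by rewrite ler_pM2l.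
have /ltW : N%:R `^ (- r) < u by exact: ku.
have : 0 < s * prime_prod k N by rewrite mulr_gt0 // (lt_le_trans ltr01) // prime_prod_ge1.
case: ifP => _; nra.
Qed.

(** A point strictly below a closure point lies below some value, hence below a finite prime
    product, and [greedy_closure] applies to it. *)
Lemma greedy_connected : connected (closure (unitary_sigma_range (- r))).
Proof.
apply/connected_intervalP => a b ca cb c /andP[ac cb'].
have a1 : 1 <= a.
  rewrite leNgt; apply/negP => a1.
  have /closure_ballP/(_ (1 - a)) := ca; rewrite subr_gt0 => /(_ a1)[_ [n n0 <-]].
  have := unitary_sigma_ge1 n0; rewrite ltr_norml; lra.
have [->//|neq] := eqVneq c b.
have lt_cb : c < b by rewrite lt_neqAle neq.
have /closure_ballP/(_ (b - c)) := cb; rewrite subr_gt0 => /(_ lt_cb)[_ [n n0 <-]] h.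
apply: (@greedy_closure c n.+1); first exact: le_trans ac.
have /andP[_] := unitary_sigma_bounds n0 (smoothS n0); apply: lt_le_trans.
by move: h; rewrite ltr_norml; lra.
Qed.

End PrimeProduct.

(** * Gaps *)

(** The midpoint of the gap lies between [a] and [d], but at distance at least [(b - c) / 2] from
    [A]. *)
Lemma not_connected_closure (R : realType) (A : set R) a d b c :
  A a -> A d -> a <= c -> c < b -> b <= d ->
  (forall y, A y -> y <= c \/ b <= y) -> ~ connected (closure A).
Proof.
move=> Aa Ad ac cb bd gap /connected_intervalP itv.
have mid : closure A ((c + b) / 2).
  by apply: (itv a d); [exact: subset_closure|exact: subset_closure|apply/andP; split; lra].
have /closure_ballP/(_ ((b - c) / 2)) := mid.
case=> [|y /gap yA]; first by lra.
by rewrite ltr_norml; case: yA => ? /andP[]; lra.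
Qed.

Lemma not_connected_nonpos (R : realType) (r : R) : r <= 0 ->
  ~ connected (closure (unitary_sigma_range (- r))).
Proof.
move=> r0; have r0' : 0 <= - r by lra.
apply: (@not_connected_closure _ _ 1 (unitary_sigma (- r) 2) 2 1) => //.
- by exists 1%N => //; rewrite unitary_sigma1.
- by exists 2%N.
- by rewrite ltr1n.
- exact: unitary_sigma_ge2.
move=> _ [n n0 <-]; have [n1|n1] := leqP n 1; last by right; exact: unitary_sigma_ge2.
by left; rewrite (_ : n = 1%N) ?unitary_sigma1 //; apply/eqP; rewrite eqn_leq n1.
Qed.

(** The cross-multiplied difference is [(x - y) (2 - (1 + x) (1 + y))]. *)
Lemma gap_ratio_le (R : realType) (x y : R) : 0 <= y <= x -> (1 + x) * (1 + y) <= 2 ->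
  gap_ratio y <= gap_ratio x.
Proof.
move=> /andP[y0 yx] h; have x0 : 0 <= x by lra.
rewrite /gap_ratio ler_pdivrMr ?ltr_wpDr ?sqr_ge0 // mulrAC ler_pdivlMr ?ltr_wpDr ?sqr_ge0 //.
have : 0 <= (x - y) * (2 - (1 + x) * (1 + y)) by rewrite mulr_ge0 ?subr_ge0.
nra.
Qed.

Lemma natpow_le_inv (R : realType) (r : R) q : 1 <= r -> (0 < q)%N ->
  q%:R `^ (- r) <= q%:R^-1 :> R.
Proof.
move=> r1 q0; rewrite -powR_inv1 ?ler0n // ler_powR ?ler1n //; lra.
Qed.

(** Here [c] bounds what the primes from 5 on contribute. If 2 and 3 both divide [n] exactly once,
    the value is at least [G = (1 + x) (1 + y)]; otherwise the loss at 2 or 3 cannot be made up by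
    [c], and the value stays at or below some [B < G]. *)
Lemma not_connected_gap (R : realType) (r c : R) : 1 <= r ->
  (forall M, prime_prod r 4 M <= c) -> c < gap_ratio (3 `^ (- r)) ->
  ~ connected (closure (unitary_sigma_range (- r))).
Proof.
move=> r1 hc cgap; have r0 : 0 < r by lra.
set y := 3 `^ (- r) in cgap *; pose x : R := 2 `^ (- r).
have x2 : x <= 2^-1 by exact: natpow_le_inv.
have y3 : y <= 3^-1 by exact: natpow_le_inv.
have y0 : 0 < y by exact: (@natpow_gt0 R r 3).
have x0 : 0 < x by exact: (@natpow_gt0 R r 2).
have yx : y <= x.
  rewrite /x /y !powRN lef_pV2 ?posrE ?powR_gt0 //.
  by apply: ge0_ler_powR; rewrite ?nnegrE; lra.
have c1 : 1 <= c by apply: le_trans (hc 0%N); exact: prime_prod_ge1.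
(* The failure at 3 carries over to 2: [x <= 1/2] and [y <= 1/3] give exactly
   [(1 + x) (1 + y) <= 2], as [gap_ratio_le] requires. *)
have cx : c < gap_ratio x.
  apply: lt_le_trans cgap _; apply: gap_ratio_le; first by rewrite ltW.
  by nra.
have cy' : c * (1 + y ^+ 2) < 1 + y by rewrite -ltr_pdivlMr ?ltr_wpDr ?sqr_ge0.
have cx' : c * (1 + x ^+ 2) < 1 + x by rewrite -ltr_pdivlMr ?ltr_wpDr ?sqr_ge0.
pose G := (1 + x) * (1 + y).
(* The two entries bound the values when the exponent of 3, respectively of 2, is not 1. *)
pose B := Num.max ((1 + x) * (c * (1 + y ^+ 2))) ((c * (1 + x ^+ 2)) * (1 + y)).
have BG : B < G.
  by rewrite /B gt_max /G ltr_pM2l ?ltr_pM2r ?cx' ?cy' //; lra.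
have sG : unitary_sigma (- r) 6 = G.
  rewrite (_ : 6 = 2 ^ 1 * (3 ^ 1 * 1))%N // unitary_sigma_mul // unitary_sigma_mul //.
  by rewrite unitary_sigma1 mulr1 !expn1.
apply: (@not_connected_closure _ _ 1 G G B) => //.
- by exists 1%N => //; rewrite unitary_sigma1.
- by exists 6%N.
- by rewrite /B le_max; apply/orP; left;
  rewrite mulr_ege1 // ?mulr_ege1 // ?lerDl ?sqr_ge0 // ltW.
move=> _ [n n0 <-].
have sn : smooth (maxn 4 n.+1) n := smooth_le (leq_maxr _ _) (smoothS n0).
rewrite (unitary_sigma_prod _ n0 sn); set b := maxn 4 n.+1.
have b4 : (4 <= b)%N by exact: leq_maxl.
rewrite (big_cat_nat (n := 4)) //= (_ : \prod_(0 <= p < 4 | prime p) local_factor (- r) p n =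
  local_factor (- r) 2 n * local_factor (- r) 3 n); last first.
  by rewrite unlock /= mulr1.
have /andP[P1 P2] := local_factors_bounds r0 4 b n0.
set P := \prod_(4 <= _ < b | _) _ in P1 P2 *.
have {}P2 : P <= c := le_trans P2 (hc b).
have P0 : 0 <= P by lra.
have [h2|/(local_factor_le2 r0 (isT : prime 2) n0) h2] := eqVneq (logn 2 n) 1%N; last first.
  left; rewrite /B le_max; apply/orP; right.
  rewrite -/x in h2; have h3 := local_factor_le r0 (isT : prime 3) n0; rewrite -/y in h3.
  rewrite [leRHS](_ : _ = (1 + x ^+ 2) * (1 + y) * c); last by ring.
  apply: ler_pM => //; first by rewrite mulr_ge0 // (le_trans ler01) ?local_factor_ge1.
  by apply: ler_pM => //; rewrite (le_trans ler01) ?local_factor_ge1.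
have [h3|/(local_factor_le2 r0 (isT : prime 3) n0) h3] := eqVneq (logn 3 n) 1%N; last first.
  left; rewrite /B le_max; apply/orP; left.
  rewrite -/y in h3; have h2' := local_factor_le r0 (isT : prime 2) n0; rewrite -/x in h2'.
  rewrite [leRHS](_ : _ = (1 + x) * (1 + y ^+ 2) * c); last by ring.
  apply: ler_pM => //; first by rewrite mulr_ge0 // (le_trans ler01) ?local_factor_ge1.
  by apply: ler_pM => //; rewrite (le_trans ler01) ?local_factor_ge1.
have dvd p : logn p n = 1%N -> (p %| n)%N.
  move=> e1; have : (0 < logn p n)%N by rewrite e1.
  by rewrite logn_gt0 mem_primes => /and3P[].
right; rewrite !local_factorE h2 h3 !expr1 !dvd //.
by rewrite -/x -/y -/G ler_peMr // mulr_ge0; lra.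
Qed.

(** * Comparison of prime powers, and reduction to the condition at 3 *)

Lemma natpow_ratio (R : realType) (r : R) p q : (0 < p)%N ->
  q%:R `^ (- r) = p%:R `^ (- r) * (p%:R / q%:R) `^ r :> R.
Proof.
move=> p0; rewrite powRM ?invr_ge0 ?ler0n // mulrA (powRN p%:R) mulVf ?mul1r; last first.
  by rewrite gt_eqF // powR_gt0 // ltr0n.
by rewrite -powR_inv1 ?ler0n // -powRrM mulN1r.
Qed.

Lemma natpow_ratio_ge (R : realType) (r : R) p q : r <= 2 -> (0 < p <= q)%N ->
  p%:R `^ (- r) * (p%:R / q%:R) ^+ 2 <= q%:R `^ (- r) :> R.
Proof.
move=> r2 /andP[p0 pq]; have q0 : (0 < q)%N by exact: leq_trans pq.
rewrite (natpow_ratio r q p0) ler_pM2l ?powR_gt0 ?ltr0n // -powR_mulrn ?divr_ge0 //.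
apply: ger_powR => //.
by rewrite divr_gt0 ?ltr0n //= ler_pdivrMr ?ltr0n // mul1r ler_nat.
Qed.

Lemma natpow_ratio_le (R : realType) (r : R) p q : 2 <= r -> (0 < p <= q)%N ->
  q%:R `^ (- r) <= p%:R `^ (- r) * (p%:R / q%:R) ^+ 2 :> R.
Proof.
move=> r2 /andP[p0 pq]; have q0 : (0 < q)%N by exact: leq_trans pq.
rewrite (natpow_ratio r q p0) ler_pM2l ?powR_gt0 ?ltr0n // -powR_mulrn ?divr_ge0 //.
apply: ger_powR => //.
by rewrite divr_gt0 ?ltr0n //= ler_pdivrMr ?ltr0n // mul1r ler_nat.
Qed.

Lemma prime_prod_ge_sum (R : realType) (r : R) a b :
  1 + \sum_(a <= q < b | prime q) q%:R `^ (- r) <= prime_prod r a b.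
Proof.
rewrite /prime_prod.
suff : 0 <= \sum_(a <= q < b | prime q) q%:R `^ (- r) :> R /\
  1 + \sum_(a <= q < b | prime q) q%:R `^ (- r) <= \prod_(a <= q < b | prime q) (1 + q%:R `^
    (- r) : R).
  by case.
elim/big_rec2: _ => [|q P S _ [S0 SP]]; first by rewrite addr0.
have := powR_ge0 q%:R (- r); split; first by rewrite addr_ge0.
by nra.
Qed.

(* For [r <= 2] we have [q^-r / p^-r >= (p / q)^2], and [gap_ratio y < 1 + y]. *)
Lemma gap_ratio_tail (R : realType) (r : R) p : 0 < r <= 2 -> prime p -> (5 <= p)%N ->
  exists M, gap_ratio (p%:R `^ (- r)) < prime_prod r p.+1 M.
Proof.
move=> /andP[r0 r2] pp p5; have p0 := prime_gt0 pp.
have [M hM] := prime_square_tail R pp p5; exists M.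
set y := p%:R `^ (- r); have y0 : 0 < y by exact: natpow_gt0.
apply: (@lt_le_trans _ _ (1 + y)).
  rewrite /gap_ratio ltr_pdivrMr ?ltr_wpDr ?sqr_ge0 // ltr_pMr; last by lra.
  by rewrite ltrDl exprn_gt0.
apply: le_trans (prime_prod_ge_sum _ _ _); rewrite lerD2l.
apply: (@le_trans _ _ (y * \sum_(p.+1 <= q < M | prime q) (p%:R / q%:R) ^+ 2)).
  by rewrite ler_peMr // ltW.
rewrite mulr_sumr big_nat_cond [leRHS]big_nat_cond; apply: ler_sum => q /andP[/andP[pq _] _].
by apply: natpow_ratio_ge; rewrite // p0 ltnW.
Qed.

(* The maximum is [(1 + sqrt 2) / 2 = 1.2071...]. *)
Lemma gap_ratio_max (R : realType) (x : R) : gap_ratio x <= 483 / 400.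
Proof.
rewrite /gap_ratio ler_pdivrMr ?ltr_wpDr ?sqr_ge0 //.
have := sqr_ge0 (x - 200 / 483); nra.
Qed.

(** For [r <= 1] the factors at 5 and 7 already give [(6/5) (8/7) > 483/400]. *)
Lemma gap_ratio3_small (R : realType) (r : R) : 0 < r <= 1 ->
  gap_ratio (3 `^ (- r)) < prime_prod r 4 8.
Proof.
move=> /andP[r0 r1]; apply: le_lt_trans (gap_ratio_max _) _.
have h q : (0 < q)%N -> q%:R^-1 <= q%:R `^ (- r) :> R.
  move=> q0; rewrite -powR_inv1 ?ler0n // ler_powR ?ler1n //; lra.
rewrite /prime_prod unlock /= mulr1.
by have := h 5 isT; have := h 7 isT; nra.
Qed.

(** The greedy condition holds at [p >= 5] by [gap_ratio_tail], and at 2 it follows from the one at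
    3: the extra factor [1 + y] lifts [gap_ratio y] above the maximum of [gap_ratio]. *)
Lemma connected_of_gap3 (R : realType) (r : R) : 0 < r <= 2 ->
  (forall e : R, 0 < e -> exists M, gap_ratio (3 `^ (- r)) < (1 + e) * prime_prod r 4 M) ->
  connected (closure (unitary_sigma_range (- r))).
Proof.
move=> r02 h3; have /andP[r0 r2] := r02.
apply: greedy_connected => // p pp e e0.
have [p5|p5] := leqP 5 p.
  have [M hM] := gap_ratio_tail r02 pp p5; exists M; apply: lt_le_trans hM _.
  rewrite ler_peMl ?lerDl ?ltW //; apply: lt_le_trans ltr01 _; exact: prime_prod_ge1.
have : p \in [:: 2; 3]%N.
  have : p \in [seq q <- iota 0 5 | prime q] by rewrite mem_filter pp mem_iota.
  by [].
rewrite !inE => /orP[] /eqP ->; last exact: h3.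
have [M hM] := h3 e e0; exists (maxn 4 M).
set y : R := 3 `^ (- r) in hM.
have y9 : 9^-1 <= y.
  apply: (@le_trans _ _ (3 `^ (- 2%:R))); last by rewrite ler_powR ?ler1n //; lra.
  by rewrite powR_invn // -natrX.
have y1 : y < 1 by exact: (@natpow_lt1 R r r0 3).
rewrite prime_prodSl ?leq_maxl //=.
apply: (@le_lt_trans _ _ (gap_ratio y * (1 + y))).
  apply: le_trans (gap_ratio_max _) _.
  rewrite /gap_ratio mulrAC ler_pdivlMr ?ltr_wpDr ?sqr_ge0 //.
  (* This says [y / (1 + y^2) >= 9/82], so [(1 + y)^2 / (1 + y^2) >= 50/41 > 483/400]. *)
  have : 0 <= (9 * y - 1) * (9 - y) by apply: mulr_ge0; lra.
  nra.
rewrite -/y mulrCA mulrC ltr_pM2l; last by lra.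
apply: lt_le_trans hM _; rewrite ler_pM2l; last by lra.
by apply: prime_prod_le; exact: leq_maxr.
Qed.

Lemma connected_small (R : realType) (r : R) : 0 < r <= 1 ->
  connected (closure (unitary_sigma_range (- r))).
Proof.
move=> r01; have /andP[r0 r1] := r01; apply: connected_of_gap3; first by rewrite r0; lra.
move=> e e0; exists 8%N; apply: lt_le_trans (gap_ratio3_small r01) _.
rewrite ler_peMl ?lerDl ?ltW //; apply: lt_le_trans ltr01 _; exact: prime_prod_ge1.
Qed.

(** * Euler product *)

Section Zeta.
Variable R : realType.
Implicit Types (a s t : R).

Lemma natpow_antitone s t n : (0 < n)%N -> s <= t -> n%:R `^ (- t) <= n%:R `^ (- s) :> R.
Proof. by move=> n0 st; rewrite ler_powR ?ler1n //; lra. Qed.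

Definition dyadic_ratio a : R := 2 `^ (1 - a).

Lemma dyadic_ratio_bounds a : 1 < a -> 0 < dyadic_ratio a < 1.
Proof.
move=> a1; rewrite /dyadic_ratio powR_gt0 //= -opprB powRN invf_lt1 ?powR_gt0 //.
have e : 1 `^ (a - 1) = 1 :> R by rewrite powR1.
by rewrite -[ltLHS]e; apply: gt0_ltr_powR; rewrite ?nnegrE; lra.
Qed.

(* Dyadic blocks: the terms with [2^k <= n < 2^(k+1)] sum to at most [2^(k (1-a))]. *)
Lemma zeta_tail a s K N : 1 < a -> a <= s ->
  \sum_(2 ^ K <= n < N) n%:R `^ (- s) <= dyadic_ratio a ^+ K / (1 - dyadic_ratio a).
Proof.
move=> a1 as'; have /andP[q0 q1] := dyadic_ratio_bounds a1; set q := dyadic_ratio a in q0 q1 *.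
have block k : \sum_(2 ^ k <= n < 2 ^ k.+1) n%:R `^ (- s) <= q ^+ k.
  apply: (@le_trans _ _ (\sum_(2 ^ k <= n < 2 ^ k.+1) (2 ^ k)%:R `^ (- a))).
    rewrite big_nat [leRHS]big_nat; apply: ler_sum => n /andP[kn _].
    have n0 : (0 < n)%N by apply: leq_trans kn; rewrite expn_gt0.
    apply: le_trans (natpow_antitone n0 as') _.
    rewrite !powRN lef_pV2 ?posrE ?powR_gt0 ?ltr0n ?expn_gt0 //.
    by apply: ge0_ler_powR; rewrite ?nnegrE ?ler0n ?ler_nat //; lra.
  rewrite sumr_const_nat expnS mul2n -addnn addnK -[leLHS]mulr_natl.
  rewrite natpowX /q /dyadic_ratio powRD; last by rewrite pnatr_eq0 implybT.
  by rewrite powRr1 // exprMn natrX.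
have blocks j : \sum_(2 ^ K <= n < 2 ^ (K + j)) n%:R `^ (- s) <= q ^+ K * (1 - q ^+ j) / (1 -
  q).
  elim: j => [|j IH]; first by rewrite addn0 big_geq // subrr mulr0 mul0r.
  rewrite (big_cat_nat (n := 2 ^ (K + j))) ?leq_exp2l ?leq_addr ?addnS //=.
  apply: le_trans (lerD IH (block _)) _.
  rewrite le_eqVlt; apply/orP; left; apply/eqP; rewrite exprD exprS.
  by field; lra.
apply: (@le_trans _ _ (\sum_(2 ^ K <= n < 2 ^ (K + N)) n%:R `^ (- s))).
  have [KN|NK] := leqP (2 ^ K) N; last first.
    by rewrite big_geq ?(ltnW NK) // sumr_ge0 // => *; exact: powR_ge0.
  have NN : (N <= 2 ^ (K + N))%N.
    by rewrite (leq_trans (ltnW (ltn_expl N (isT : 1 < 2)%N))) // leq_exp2l ?leq_addl.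
  by rewrite (big_cat_nat KN NN) /= lerDl sumr_ge0 // => *; exact: powR_ge0.
apply: le_trans (blocks N) _; rewrite ler_pM2r ?invr_gt0; last by lra.
have qj j : 0 <= q ^+ j by rewrite exprn_ge0 // ltW.
by rewrite ler_piMr // gerBl.
Qed.

Definition rough k n := all (leq k) (primes n).

Lemma roughP k n : (0 < n)%N ->
  reflect (forall p, prime p -> (p %| n)%N -> (k <= p)%N) (rough k n).
Proof.
move=> n0; apply: (iffP allP) => h p.
  by move=> pp pn; apply: h; rewrite mem_primes pp n0.
by rewrite mem_primes => /and3P[pp _ pn]; exact: h.
Qed.

Lemma roughS k n : (0 < n)%N -> rough k.+1 n = rough k n && ~~ (prime k && (k %| n)%N).
Proof.
move=> n0; apply/(roughP _ n0)/andP => [h|[/(roughP _ n0) h kn] p pp pn].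
  split; first by apply/(roughP _ n0) => p pp pn; exact/ltnW/h.
  by apply/negP => /andP[kp kn]; have := h k kp kn; rewrite ltnn.
rewrite ltn_neqAle h // andbT; apply: contraNneq kn => ->.
by rewrite pp.
Qed.

Lemma rough_mul k n : prime k -> (0 < n)%N -> rough k (k * n) = rough k n.
Proof.
move=> kp n0; have kn0 : (0 < k * n)%N by rewrite muln_gt0 prime_gt0.
apply/(roughP _ kn0)/(roughP _ n0) => h p pp.
  by move=> pn; apply: h => //; exact: dvdn_mull.
by rewrite Euclid_dvdM // dvdn_prime2 // => /orP[/eqP ->//|]; exact: h.
Qed.

Definition rough_sum s k N : R := \sum_(1 <= n < N.+1 | rough k n) n%:R `^ (- s).

Lemma rough_sum_homo s k : nondecreasing_seq (rough_sum s k).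
Proof.
apply/nondecreasing_seqP => N; rewrite /rough_sum [leRHS]big_mkcond big_nat_recr //=
  -big_mkcond.
by rewrite lerDl; case: ifP => // _; exact: powR_ge0.
Qed.

(** A [k]-rough [n > 1] is at least its least prime factor, hence at least [2^K]: only the term 1
    and the tail remain. *)
Lemma rough_sum_le s k K N : 1 < s -> (2 ^ K <= k)%N ->
  rough_sum s k N <= 1 + dyadic_ratio s ^+ K / (1 - dyadic_ratio s).
Proof.
move=> s1 Kk; apply: le_trans (lerD (lexx 1) (zeta_tail K N.+1 s1 (lexx s))).
have F0 (n : nat) : 0 <= n%:R `^ (- s) :> R by exact: powR_ge0.
have K0 : (0 < 2 ^ K)%N by rewrite expn_gt0.
rewrite /rough_sum; have [KN|NK] := leqP (2 ^ K) N.+1; last first.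
  have [->|N0] := posnP N; first by rewrite big_geq // addr_ge0 // sumr_ge0.
  rewrite big_ltn_cond ?ltnS //= powR1 big1_seq ?lerD2l ?sumr_ge0 // => n.
  rewrite mem_index_iota => /andP[+ /andP[n2 nN]].
  have n1 : (1 < n)%N by [].
  move=> /(roughP _ (ltnW n1))/(_ _ (pdiv_prime n1) (pdiv_dvd n)).
  by have := pdiv_leq (ltnW n1); lia.
rewrite (big_cat_nat K0 KN) /=; apply: lerD; last first.
  rewrite [leLHS]big_mkcond; apply: ler_sum => n _; by case: ifP.
have [->|K1] := posnP K; first by rewrite big_geq.
have K2 : (1 < 2 ^ K)%N by rewrite -[X in (X < _)%N](expn0 2) ltn_exp2l.
rewrite (big_ltn_cond K2) /= powR1 big1_seq ?addr0 // => n.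
rewrite mem_index_iota => /andP[+ /andP[n2 nN]].
have n1 : (1 < n)%N by [].
move=> /(roughP _ (ltnW n1))/(_ _ (pdiv_prime n1) (pdiv_dvd n)).
by have := pdiv_leq (ltnW n1); lia.
Qed.

Lemma rough_sum_is_cvg s k : 1 < s -> cvgn (rough_sum s k).
Proof.
move=> s1; apply: nondecreasing_is_cvgn; first exact: rough_sum_homo.
exists (dyadic_ratio s ^+ 0 / (1 - dyadic_ratio s)) => _ [N _ <-].
apply: le_trans (zeta_tail 0 N.+1 s1 (lexx s)).
rewrite /rough_sum [leLHS]big_mkcond; apply: ler_sum => n _.
by case: ifP => // _; exact: powR_ge0.
Qed.

(** The zeta function with the Euler factors at the primes below [k] removed, as a series rather
    than an infinite product. *)
Definition rough_zeta s k : R := limn (rough_sum s k).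

Lemma rough_sum_le_zeta s k N : 1 < s -> rough_sum s k N <= rough_zeta s k.
Proof.
move=> s1; apply: nondecreasing_cvgn_le; [exact: rough_sum_homo|exact: rough_sum_is_cvg].
Qed.

Lemma rough_zeta_ge1 s k : 1 < s -> 1 <= rough_zeta s k.
Proof.
move=> s1; apply: le_trans (rough_sum_le_zeta k 1 s1).
by rewrite /rough_sum big_mkcond big_nat1 /= powR1.
Qed.

Lemma rough_zeta_le s k K : 1 < s -> (2 ^ K <= k)%N ->
  rough_zeta s k <= 1 + dyadic_ratio s ^+ K / (1 - dyadic_ratio s).
Proof.
move=> s1 Kk; apply: limr_le; first exact: rough_sum_is_cvg.
by apply: nearW => N; exact: rough_sum_le.
Qed.

Lemma rough_zeta_antitone s t k : 1 < s -> s <= t -> rough_zeta t k <= rough_zeta s k.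
Proof.
move=> s1 st; have t1 : 1 < t by lra.
apply: limr_le; first exact: rough_sum_is_cvg.
apply: nearW => N; apply: le_trans (rough_sum_le_zeta k N s1).
rewrite /rough_sum big_nat_cond [leRHS]big_nat_cond.
by apply: ler_sum => n /andP[/andP[n0 _] _]; exact: natpow_antitone.
Qed.

Lemma zetaE s : rough_zeta s 0 = zeta s.
Proof.
rewrite /rough_zeta /zeta; congr (limn _); apply/funext => N.
rewrite /rough_sum /series /= big_add1 /= big_nat_cond [RHS]big_nat_cond.
apply: eq_big => [n|n _]; last by rewrite powRN.
have -> : rough 0 n.+1 by apply/(roughP _ (ltn0Sn n)).
by [].
Qed.

(* Reindexing for the sieve step [Z_(k+1) = (1 - k^-s) Z_k]. *)
Lemma sum_multiples (F : nat -> R) (P : pred nat) k N : (0 < k)%N ->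
  \sum_(1 <= n < (k * N).+1 | P n && (k %| n)%N) F n =
  \sum_(1 <= m < N.+1 | P (k * m)%N) F (k * m)%N.
Proof.
move=> k0; elim: N => [|N IH]; first by rewrite muln0 !big_geq.
rewrite [RHS]big_mkcond big_nat_recr //= -big_mkcond -IH /=.
have [h1 h2] : ((k * N).+1 <= k * N.+1 /\ 1 <= k * N.+1)%N by rewrite mulnS; lia.
rewrite (big_cat_nat (n := (k * N).+1)) ?ltnS ?leq_mul2l ?leqnSn ?orbT //=; congr (_ + _).
rewrite big_mkcond big_nat_recr //= dvdn_mulr // andbT big1_seq ?add0r // => n.
rewrite mem_index_iota => /andP[_ /andP[ln nu]]; case: ifP => // /andP[_ /dvdnP[m em]].
by move: ln nu; rewrite em (mulnC m) ltn_pmul2l // ltn_pmul2l // ltnS leqNgt => /negP.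
Qed.

(** Among the [k]-rough integers up to [k N], those prime to [k] are [(k + 1)]-rough, and the
    multiples of [k] are [k m] with [m <= N] again [k]-rough. The limit is taken along [k N]. *)
Lemma rough_zetaS s k : 1 < s ->
  rough_zeta s k.+1 = (if prime k then 1 - k%:R `^ (- s) else 1) * rough_zeta s k.
Proof.
move=> s1; case: ifP => kp; last first.
  rewrite mul1r; congr (limn _); apply/funext => N; rewrite /rough_sum.
  rewrite big_nat_cond [RHS]big_nat_cond; apply: eq_bigl => n.
  by case: n => [|n]; rewrite //= roughS // kp andbT.
have k0 := prime_gt0 kp.
have split N : rough_sum s k (k * N) = rough_sum s k.+1 (k * N) + k%:R `^ (- s) * rough_sum s
  k N.
  rewrite /rough_sum (bigID (fun n => k %| n)%N) /= addrC; congr (_ + _).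
    rewrite big_nat_cond [RHS]big_nat_cond; apply: eq_bigl => n.
    by case: n => [|n]; rewrite //= roughS // kp.
  rewrite sum_multiples // [LHS]big_nat_cond mulr_sumr [RHS]big_nat_cond.
  apply: eq_big => [n|n _]; last by rewrite natrM powRM.
  by case: n => [|n]; rewrite //= rough_mul.
have kN : (fun N => (k * N)%N) N @[N --> \oo] --> \oo.
  by apply/cvgnyPge => A; exists A => // N /= AN; apply: leq_trans AN _; exact: leq_pmull.
have c1 : rough_sum s k (k * N) @[N --> \oo] --> rough_zeta s k.
  by apply: (cvg_comp _ (rough_sum s k) kN); exact: rough_sum_is_cvg.
have c2 : rough_sum s k.+1 (k * N) @[N --> \oo] --> rough_zeta s k.+1.
  by apply: (cvg_comp _ (rough_sum s k.+1) kN); exact: rough_sum_is_cvg.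
have c3 : rough_sum s k.+1 (k * N) + k%:R `^ (- s) * rough_sum s k N @[N --> \oo]
    --> rough_zeta s k.+1 + k%:R `^ (- s) * rough_zeta s k.
  by apply: cvgD => //; apply: cvgMr; exact: rough_sum_is_cvg.
have : rough_zeta s k = rough_zeta s k.+1 + k%:R `^ (- s) * rough_zeta s k.
  rewrite (funext split : (fun N => rough_sum s k (k * N)) = _) in c1.
  exact: etrans (esym (cvg_lim (@Rhausdorff R) c1)) (cvg_lim (@Rhausdorff R) c3).
by lra.
Qed.

Lemma zeta_gt0 s : 1 < s -> 0 < zeta s.
Proof. by move=> s1; rewrite -zetaE (lt_le_trans ltr01) // rough_zeta_ge1. Qed.

(** Each step uses [(1 + x) (1 - x) = 1 - x^2], where [1 - x] and [1 - x^2] are the sieve factors at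
    [s] and [2 s]. *)
Lemma euler_prime_prod s M : 1 < s ->
  prime_prod s 0 M * rough_zeta s M * zeta (2 * s) = zeta s * rough_zeta (2 * s) M.
Proof.
move=> s1; have s2 : 1 < 2 * s by lra.
elim: M => [|M IH]; first by rewrite /prime_prod big_geq // !zetaE mul1r.
rewrite prime_prodS // !rough_zetaS //; case: ifP => pM; last by rewrite mulr1 !mul1r.
rewrite (_ : - (2 * s) = - s * 2); last by ring.
rewrite powRrM (powR_mulrn 2) ?powR_ge0 //.
have E (P x Z z2 w: R) : P * Z * z2 = w -> P * (1 + x) * ((1 - x) * Z) * z2 = (1 - x ^+ 2) * w.
  by move=> <-; ring.
by rewrite (E _ _ _ _ _ IH); ring.
Qed.

(** In [euler_prime_prod] the leftover factors satisfy [rough_zeta (2 * s) M <= rough_zeta s M]. *)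
Lemma prime_prod_le_zeta s M : 1 < s -> prime_prod s 0 M <= zeta s / zeta (2 * s).
Proof.
move=> s1; have s2 : 1 < 2 * s by lra.
rewrite ler_pdivlMr ?zeta_gt0 //.
have z1 := rough_zeta_ge1 M s1.
have := euler_prime_prod M s1.
have := @rough_zeta_antitone s (2 * s) M s1 ltac:(lra).
have := zeta_gt0 s1; move: (prime_prod _ _ _) (zeta _) (zeta _) (rough_zeta _ _) (rough_zeta _
  _) z1.
move=> P z z2 Z Z2 Z1 z0 ZZ e.
rewrite -(ler_pM2r (lt_le_trans ltr01 Z1)) mulrAC e ler_pM2l //.
Qed.

(** In [euler_prime_prod] the leftover factor [rough_zeta s M] tends to 1 along [M = 2^K], and the
    one at [2 s] is at least 1. *)
Lemma prime_prod_near_zeta s e : 1 < s -> 0 < e ->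
  exists M, zeta s / zeta (2 * s) < (1 + e) * prime_prod s 0 M.
Proof.
move=> s1 e0; have s2 : 1 < 2 * s by lra.
have /andP[q0 q1] := dyadic_ratio_bounds s1; set q := dyadic_ratio s in q0 q1.
have [K hK] : exists K, q ^+ K < e * (1 - q).
  by apply: exprn_small; [rewrite ltW|rewrite mulr_gt0 // subr_gt0].
exists (2 ^ K)%N; rewrite ltr_pdivrMr ?zeta_gt0 //.
have Zle : rough_zeta s (2 ^ K) < 1 + e.
  apply: le_lt_trans (rough_zeta_le s1 (leqnn _)) _.
  by rewrite ltrD2l ltr_pdivrMr // subr_gt0.
have z1 := rough_zeta_ge1 (2 ^ K) s2.
have E := euler_prime_prod (2 ^ K) s1.
have z0 := zeta_gt0 s1; have z20 := zeta_gt0 s2.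
have P1 := prime_prod_ge1 s 0 (2 ^ K).
apply: (@le_lt_trans _ _ (zeta s * rough_zeta (2 * s) (2 ^ K))).
  by rewrite ler_peMr // ltW.
rewrite -E ltr_pM2r // mulrC ltr_pM2r //; lra.
Qed.

End Zeta.

(** * The quotient [zeta s / zeta (2 s)] *)

Section ZetaRatio.
Variable R : realType.
Implicit Types (a s t r : R).

Definition zeta_head K s : R := \sum_(1 <= n < 2 ^ K) n%:R `^ (- s).

Lemma zeta_sum_le s N : 1 < s -> \sum_(1 <= n < N.+1) n%:R `^ (- s) <= zeta s.
Proof.
move=> s1; apply: le_trans (_ : rough_sum s 0 N <= _); last by rewrite -zetaE rough_sum_le_zeta.
rewrite /rough_sum big_nat_cond [leRHS]big_nat_cond le_eqVlt; apply/orP; left; apply/eqP.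
apply: eq_bigl => n; case: n => [|n] //=.
by have -> : rough 0 n.+1 by apply/(roughP _ (ltn0Sn n)).
Qed.

Lemma zeta_le_of_sums s B N0 : 1 < s ->
  (forall N, (N0 <= N)%N -> \sum_(1 <= n < N.+1) n%:R `^ (- s) <= B) -> zeta s <= B.
Proof.
move=> s1 h; rewrite -zetaE; apply: limr_le; first exact: rough_sum_is_cvg.
apply: nearW => N; apply: le_trans (h (maxn N0 N) (leq_maxl _ _)).
apply: le_trans (rough_sum_homo s 0 (leq_maxr N0 N)) _.
by rewrite /rough_sum [leLHS]big_mkcond; apply: ler_sum => n _; case: ifP => // _;
  exact: powR_ge0.
Qed.

(** The error depends only on [a], so the partial sums converge uniformly on [s >= a]; continuity of
    [zeta] rests on this. *)
Lemma zeta_head_bounds a s K : 1 < a -> a <= s ->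
  zeta_head K s <= zeta s <= zeta_head K s + dyadic_ratio a ^+ K / (1 - dyadic_ratio a).
Proof.
move=> a1 as'; have s1 : 1 < s by lra.
have K0 : (0 < 2 ^ K)%N by rewrite expn_gt0.
apply/andP; split.
  by have := zeta_sum_le (2 ^ K).-1 s1; rewrite prednK.
apply: (@zeta_le_of_sums _ _ (2 ^ K)) => // N KN.
rewrite (big_cat_nat (n := 2 ^ K)) //=; last exact: leqW.
by rewrite lerD2l zeta_tail.
Qed.

Lemma continuous_natpow q s : (0 < q)%N -> q%:R `^ (- t) @[t --> s] --> (q%:R `^ (- s) : R).
Proof.
move=> q0; have q0' : q%:R == 0 :> R = false by apply/negbTE; rewrite pnatr_eq0 -lt0n.
rewrite /powR q0'; apply: (cvg_comp (fun t => - t * ln q%:R) (@expR R));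
  last exact: continuous_expR.
by apply: cvgMl; apply: cvgN; exact: cvg_id.
Qed.

Lemma continuous_zeta_head K s : zeta_head K t @[t --> s] --> zeta_head K s.
Proof.
rewrite /zeta_head; elim: (2 ^ K)%N => [|N IH].
  by under eq_cvg do rewrite big_geq //; rewrite big_geq //; exact: cvg_cst.
have [->|N0] := posnP N; first by under eq_cvg do rewrite big_geq //; rewrite big_geq //;
  exact: cvg_cst.
under eq_cvg do rewrite big_nat_recr //=; rewrite big_nat_recr //=.
by apply: cvgD => //; exact: continuous_natpow.
Qed.

Lemma continuous_zeta s : 1 < s -> zeta t @[t --> s] --> zeta s.
Proof.
move=> s1; pose a := (1 + s) / 2; have a1 : 1 < a by rewrite /a; lra.
have as' : a < s by rewrite /a; lra.
have /andP[q0 q1] := dyadic_ratio_bounds a1; set q := dyadic_ratio a in q0 q1.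
apply/cvgrPdist_lt => e e0.
have [K hK] : exists K, q ^+ K < e / 2 * (1 - q).
  by apply: exprn_small; [rewrite ltW|rewrite mulr_gt0 ?divr_gt0 ?subr_gt0].
have tau : q ^+ K / (1 - q) < e / 2 by rewrite ltr_pdivrMr ?subr_gt0.
have e2 : 0 < e / 2 by rewrite divr_gt0.
have /cvgrPdist_lt/(_ _ e2) head_near := @continuous_zeta_head K s.
apply: filterS2 (lt_nbhsr as') head_near => t at' ht.
have /andP[h1 h2] := zeta_head_bounds K a1 (ltW as').
have /andP[h3 h4] := zeta_head_bounds K a1 (ltW at').
rewrite -/q in h2 h4; move: ht; rewrite !ltr_norml; lra.
Qed.

Definition zeta_ratio s : R := zeta s / zeta (2 * s).

(** [zeta_ratio s] is the supremum of the prime products, so a common bound passes to it. *)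
Lemma zeta_ratio_le s B : 1 < s -> (forall M, prime_prod s 0 M <= B) -> zeta_ratio s <= B.
Proof.
move=> s1 h; rewrite leNgt; apply/negP => BQ.
have B0 : 0 < B by apply: lt_le_trans (h 0%N); apply: lt_le_trans ltr01 _;
  exact: prime_prod_ge1.
have e0 : 0 < (zeta_ratio s - B) / B by rewrite divr_gt0 // subr_gt0.
have [M hM] := prime_prod_near_zeta s1 e0.
suff : zeta_ratio s < zeta_ratio s by rewrite ltxx.
apply: lt_le_trans hM _.
have E : (1 + (zeta_ratio s - B) / B) * B = zeta_ratio s by field; rewrite gt_eqF.
rewrite -[leRHS]E ler_pM2l ?addr_gt0 //; exact: h.
Qed.

Lemma continuous_zeta_ratio s : 1 < s -> zeta_ratio t @[t --> s] --> zeta_ratio s.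
Proof.
move=> s1; have s2 : 1 < 2 * s by lra.
apply: cvgM; first exact: continuous_zeta.
apply: cvgV; first by rewrite gt_eqF // zeta_gt0.
apply: (@cvg_comp _ _ _ (fun t => 2 * t) (@zeta R) _ (nbhs (2 * s)));
  last exact: continuous_zeta.
by apply: cvgMr; exact: cvg_id.
Qed.

(** * Monotonicity of the quotient of the two sides of the equation *)

Definition eta_lhs s : R := (1 + 2 `^ (- s)) * (1 + 3 `^ (- s)) * gap_ratio (3 `^ (- s)).

Lemma eta_lhs_gt0 s : 0 < eta_lhs s.
Proof.
rewrite /eta_lhs /gap_ratio.
have := powR_ge0 2 (- s); have := powR_ge0 3 (- s); set y := _ `^ _; set x := _ `^ _ => y0 x0.
by rewrite !mulr_gt0 ?invr_gt0 ?ltr_wpDr ?sqr_ge0 //; lra.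
Qed.

Lemma eta_star_equationE s : eta_star_equation s <-> eta_lhs s = zeta_ratio s.
Proof.
rewrite /eta_star_equation -/(zeta_ratio s); suff -> :
  (2 `^ s + 1) / 2 `^ s * ((3 `^ s + 1) ^+ 2 / (3 `^ (2 * s) + 1)) = eta_lhs s by [].
rewrite /eta_lhs /gap_ratio !powRN (mulrC 2 s) (powRrM 3) (powR_mulrn 2) ?powR_ge0 //.
have : 0 < 2 `^ s :> R by exact: powR_gt0.
have : 0 < 3 `^ s :> R by exact: powR_gt0.
move: (3 `^ s) (2 `^ s) => y x y0 x0; field.
by rewrite !gt_eqF // ltr_wpDl ?sqr_ge0.
Qed.

Lemma continuous_eta_lhs s : eta_lhs t @[t --> s] --> eta_lhs s.
Proof.
have c2 := @continuous_natpow 2 s isT; have c3 := @continuous_natpow 3 s isT.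
have c (f : R -> R) : f t @[t --> s] --> f s -> 1 + f t @[t --> s] --> 1 + f s.
  by move=> fs; apply: cvgD => //; exact: cvg_cst.
apply: cvgM; first by apply: cvgM; exact: c.
apply: cvgM; first exact: c.
apply: cvgV; first by rewrite gt_eqF // ltr_wpDr ?sqr_ge0.
by apply: (c (fun t => (3 `^ (- t)) ^+ 2)); rewrite expr2; apply: cvgM.
Qed.

(* With [y = 3^-t], [z = 5^-t], [w = 7^-t] and [1 + e = 3^(t - s)]: passing from [t]
   to [s] multiplies [z] and [w] by at least [1 + 4/3 e] and [1 + 5/3 e], because
   [3^4 <= 5^3] and [3^5 <= 7^3]. *)
Lemma gap_quotient_lt (y z w e z' w' : R) : 9^-1 <= y -> y * (1 + e) <= 3^-1 -> 0 < e ->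
  9 / 25 * y <= z -> z * (1 + 4 / 3 * e) <= z' ->
  9 / 49 * y <= w -> w * (1 + 5 / 3 * e) <= w' ->
  (1 + z) * (1 + w) / gap_ratio y < (1 + z') * (1 + w') / gap_ratio (y * (1 + e)).
Proof.
move=> y9 ye3 e0 zy zz wy ww.
have y0 : 0 < y by lra.
have y3 : y <= 3^-1 by nra.
rewrite /gap_ratio !invf_div !mulrA.
rewrite ltr_pdivrMr; last by lra.
rewrite [ltRHS]mulrAC ltr_pdivlMr; last by rewrite addr_gt0 // mulr_gt0; lra.
(* After clearing denominators, each of three factors grows by some [1 + c y e]. The constants 3/7
   and 15/52 come from [y <= 1/3] and the least [z] and [w], and 9/41 from [y >= 1/9]. *)
have hz : (1 + z) * (1 + 3 / 7 * y * e) <= 1 + z'.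
  apply: le_trans (_ : 1 + z * (1 + 4 / 3 * e) <= _); last by rewrite lerD2l.
  have : y * (1 + z) * (3 / 7) <= 4 / 3 * z by nra.
  nra.
have hw : (1 + w) * (1 + 15 / 52 * y * e) <= 1 + w'.
  apply: le_trans (_ : 1 + w * (1 + 5 / 3 * e) <= _); last by rewrite lerD2l.
  have : y * (1 + w) * (15 / 52) <= 5 / 3 * w by nra.
  nra.
have hy : (1 + y ^+ 2) * (1 + 9 / 41 * y * e) <= 1 + (y * (1 + e)) ^+ 2.
  have h : 9 / 41 * (1 + y ^+ 2) <= 2 * y by nra.
  have : 9 / 41 * (1 + y ^+ 2) * (y * e) <= 2 * y * (y * e) by rewrite ler_wpM2r //
    mulr_ge0 ?ltW.
  have : 0 <= y ^+ 2 * e ^+ 2 by rewrite mulr_ge0 ?sqr_ge0.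
  lra.
(* The three constants add up to more than 9/10, and [1 + y >= 10/9]. *)
have hr : 1 + y * (1 + e) < (1 + y) * (1 + (3 / 7 + 15 / 52 + 9 / 41) * y * e).
  have ye : 0 < y * e by rewrite mulr_gt0.
  have : 1 * (y * e) < (1 + y) * (3 / 7 + 15 / 52 + 9 / 41) * (y * e) by rewrite ltr_pM2r //;
    lra.
  lra.
pose d := y * e; have d0 : 0 < d by rewrite mulr_gt0.
have hm : 1 + (3 / 7 + 15 / 52 + 9 / 41) * d <= (1 + 3 / 7 * d) * (1 + 15 / 52 * d) * (1 + 9 /
  41 * d).
  have : 0 <= d * d by rewrite mulr_ge0 ?ltW.
  have : 0 <= d * d * d by rewrite !mulr_ge0 ?ltW.
  nra.
rewrite -!(mulrA _ y e) -/d in hz hw hy hr.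
apply: (@lt_le_trans _ _ ((1 + z) * (1 + w) * (1 + y ^+ 2) *
   ((1 + y) * (1 + (3 / 7 + 15 / 52 + 9 / 41) * d)))).
  rewrite ltr_pM2l // !mulr_gt0 ?ltr_wpDr ?sqr_ge0 //; lra.
apply: (@le_trans _ _ (((1 + z) * (1 + 3 / 7 * d)) * ((1 + w) * (1 + 15 / 52 * d)) *
   ((1 + y ^+ 2) * (1 + 9 / 41 * d)) * (1 + y))).
  have : 0 <= (1 + z) * (1 + w) * (1 + y ^+ 2) * (1 + y).
    by rewrite !mulr_ge0 ?addr_ge0 ?sqr_ge0 //; lra.
  set W := _ * (1 + y) => W0.
  rewrite (_ : _ * ((1 + y) * _) = W * (1 + (3 / 7 + 15 / 52 + 9 / 41) * d));
    last by rewrite /W; ring.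
  rewrite [leRHS](_ : _ = W * ((1 + 3 / 7 * d) * (1 + 15 / 52 * d) * (1 + 9 / 41 * d)));
    last by rewrite /W; ring.
  exact: ler_wpM2l.
rewrite ler_pM2r; last by lra.
have p (k : R) : 0 <= k -> 0 <= 1 + k * d by move=> k0; rewrite addr_ge0 // mulr_ge0 // ltW.
apply: ler_pM => //; first by rewrite !mulr_ge0 ?p //; lra.
  by rewrite mulr_ge0 ?p ?addr_ge0 ?sqr_ge0 //; lra.
by apply: ler_pM => //; rewrite mulr_ge0 ?p //; lra.
Qed.

Definition four_primes s : R :=
  (1 + 2 `^ (- s)) * (1 + 3 `^ (- s)) * ((1 + 5 `^ (- s)) * (1 + 7 `^ (- s))).

Lemma prime_prod_four s M : (11 <= M)%N -> prime_prod s 0 M = four_primes s * prime_prod s 11 M.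
Proof.
move=> M11; rewrite (@prime_prod_cat _ s 0 11 M) //; congr (_ * _).
by rewrite /prime_prod unlock /= mulr1 /four_primes !mulrA.
Qed.

Lemma prime_prod_three s M : (4 <= M)%N ->
  prime_prod s 0 M = (1 + 2 `^ (- s)) * (1 + 3 `^ (- s)) * prime_prod s 4 M.
Proof.
move=> M4; rewrite (@prime_prod_cat _ s 0 4 M) //; congr (_ * _).
by rewrite /prime_prod unlock /= mulr1.
Qed.

Lemma prime_prod_antitone s t (a b : nat) : s <= t -> prime_prod t a b <= prime_prod s a b.
Proof.
move=> st; apply: ler_prod => q pq; rewrite addr_ge0 ?powR_ge0 //= lerD2l.
by apply: natpow_antitone; first exact: prime_gt0.
Qed.

Lemma four_primes_gt0 s : 0 < four_primes s.
Proof. by rewrite /four_primes !mulr_gt0 // ltr_wpDr ?powR_ge0. Qed.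

(** [zeta_ratio / four_primes] is the product over the primes from 11 on, and each of its factors
    decreases in the exponent. *)
Lemma zeta_ratio_four s t : 1 < s -> s <= t ->
  zeta_ratio t * four_primes s <= zeta_ratio s * four_primes t.
Proof.
move=> s1 st; have t1 : 1 < t by lra.
rewrite -ler_pdivlMr ?four_primes_gt0 //; apply: zeta_ratio_le => // M.
apply: le_trans (prime_prod_le t 0 (leq_maxl M 11)) _.
rewrite ler_pdivlMr ?four_primes_gt0 // prime_prod_four ?leq_maxr //.
rewrite mulrAC [leRHS]mulrC -mulrA ler_pM2l ?four_primes_gt0 //.
apply: le_trans (ler_wpM2l (ltW (four_primes_gt0 s)) (prime_prod_antitone 11 (maxn M 11) st)) _.
by rewrite -prime_prod_four ?leq_maxr // prime_prod_le_zeta.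
Qed.

(** The factors at 2 and 3 cancel in [four_primes / eta_lhs], which leaves the quotient treated in
    [gap_quotient_lt]. *)
Lemma four_primes_ratio s t : 1 <= s -> s < t -> t <= 2 ->
  four_primes t * eta_lhs s < four_primes s * eta_lhs t.
Proof.
(* With [v^3 = 3^(t - s)], the inequalities [3^4 <= 5^3] and [3^5 <= 7^3] become [v^4 <= 5^(t - s)]
   and [v^5 <= 7^(t - s)]. *)
move=> s1 st t2; pose d := (t - s) / 3; pose v : R := 3 `^ d.
have d0 : 0 < d by rewrite /d; lra.
have v1 : 1 < v.
  have e : 1 `^ d = 1 :> R by rewrite powR1.
  by rewrite -e /v; apply: gt0_ltr_powR; rewrite ?nnegrE; lra.
have shift (q : nat) : (0 < q)%N -> q%:R `^ (- s) = q%:R `^ (- t) * (q%:R `^ d) ^+ 3 :> R.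
  move=> q0; rewrite -powR_mulrn ?powR_ge0 // -powRrM -powRD; first by congr powR; rewrite /d;
    field.
  by rewrite pnatr_eq0 -lt0n q0 implybT.
have powX (q j : nat) : (q%:R `^ d) ^+ j = (q ^ j)%:R `^ d :> R.
  by rewrite -powR_mulrn ?powR_ge0 // powRAC powR_mulrn ?ler0n // natrX.
have vpow (q j : nat) : (3 ^ j <= q ^ 3)%N -> v ^+ j <= (q%:R `^ d) ^+ 3.
  move=> le; rewrite (powX 3) powX.
  by apply: ge0_ler_powR; rewrite ?nnegrE ?ler0n ?ler_nat // ltW.
pose e := v ^+ 3 - 1.
have e0 : 0 < e by rewrite /e subr_gt0 exprn_egt1.
have b4 : 1 + 4 / 3 * e <= v ^+ 4.
  (* The product expands to [3 v^4 - 4 v^3 + 1]; the analogous one for [b5] to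
     [3 v^5 - 5 v^3 + 2]. *)
  have : 0 <= (v - 1) ^+ 2 * (3 * v ^+ 2 + 2 * v + 1).
    by rewrite mulr_ge0 ?sqr_ge0 // ?addr_ge0 ?mulr_ge0 ?sqr_ge0 //; lra.
  rewrite /e; nra.
have b5 : 1 + 5 / 3 * e <= v ^+ 5.
  have : 0 <= (v - 1) ^+ 2 * (3 * v ^+ 3 + 6 * v ^+ 2 + 4 * v + 2).
    by rewrite mulr_ge0 ?sqr_ge0 // ?addr_ge0 ?mulr_ge0 ?sqr_ge0 ?exprn_ge0 //; lra.
  rewrite /e; nra.
have y9 : 9^-1 <= 3 `^ (- t) :> R.
  apply: (@le_trans _ _ (3 `^ (- 2%:R))); last by rewrite ler_powR ?ler1n //; lra.
  by rewrite powR_invn // -natrX.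
have ys : 3 `^ (- s) = 3 `^ (- t) * (1 + e) :> R.
  by rewrite (shift 3) // /e -/v; congr (_ * _); ring.
have z := @natpow_ratio_ge R t 3 5 t2 isT.
have w := @natpow_ratio_ge R t 3 7 t2 isT.
have H := @gap_quotient_lt (3 `^ (- t)) (5 `^ (- t)) (7 `^ (- t)) e (5 `^ (- s)) (7 `^ (- s)).
have {}H : (1 + 5 `^ (- t)) * (1 + 7 `^ (- t)) / gap_ratio (3 `^ (- t)) <
   (1 + 5 `^ (- s)) * (1 + 7 `^ (- s)) / gap_ratio (3 `^ (- s)) :> R.
  rewrite ys; apply: H => //.
  - by rewrite -ys; exact: (@natpow_le_inv R s 3).
  - by apply: le_trans z; rewrite mulrC expr_div_n -!natrX.
  - rewrite (shift 5) // ler_pM2l ?powR_gt0 //; apply: le_trans b4 _; exact: vpow.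
  - by apply: le_trans w; rewrite mulrC expr_div_n -!natrX.
  - rewrite (shift 7) // ler_pM2l ?powR_gt0 //; apply: le_trans b5 _; exact: vpow.
have g q : 0 < gap_ratio (3 `^ (- q) : R).
  by rewrite /gap_ratio divr_gt0 // ltr_wpDr ?powR_ge0 ?sqr_ge0.
rewrite ltr_pdivrMr // mulrAC ltr_pdivlMr // in H.
rewrite /four_primes /eta_lhs.
have x0 q : 0 < (1 + 2 `^ (- q)) * (1 + 3 `^ (- q)) :> R.
  by rewrite mulr_gt0 // ltr_wpDr ?powR_ge0.
rewrite mulrACA [ltRHS]mulrACA [ltLHS]mulrC [ltRHS]mulrC [X in _ < _ * X]mulrC ltr_pM2r //.
Qed.

(** Strict decrease of [zeta_ratio / eta_lhs], as the product of [zeta_ratio / four_primes] and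
    [four_primes / eta_lhs]. *)
Lemma zeta_ratio_crossing s t : 1 < s -> s < t -> t <= 2 ->
  zeta_ratio t * eta_lhs s < zeta_ratio s * eta_lhs t.
Proof.
move=> s1 st t2; have h1 := zeta_ratio_four s1 (ltW st).
have h2 := four_primes_ratio (ltW s1) st t2.
have Fs := four_primes_gt0 s; have Ft := four_primes_gt0 t.
have Q : 0 < zeta_ratio s by rewrite divr_gt0 ?zeta_gt0 //; lra.
have L := eta_lhs_gt0 s.
rewrite -(ltr_pM2l Fs).
apply: (@le_lt_trans _ _ (zeta_ratio s * (four_primes t * eta_lhs s))).
  by rewrite [leLHS]mulrA (mulrC (four_primes s)) [leRHS]mulrA ler_pM2r.
by rewrite [ltRHS]mulrCA ltr_pM2l.
Qed.

End ZetaRatio.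

(** * Explicit estimates for exponents at least 2 and at 5/4 *)

Section ZetaRatioBounds.
Variable R : realType.
Implicit Types (s t r : R).

Lemma natpow_neg_nat (q j : nat) : q%:R `^ (- j%:R) = q%:R ^- j :> R.
Proof. by rewrite powR_invn. Qed.

(** After six terms the series is bounded by telescoping [1/n^2 <= 1/(n - 1/2) - 1/(n + 1/2)]. *)
Lemma zeta2_le : zeta 2 <= 617 / 375 :> R.
Proof.
apply: (@zeta_le_of_sums _ _ _ 6) => // [|N N6]; first by lra.
suff h : \sum_(1 <= n < N.+1) n%:R `^ (- 2) <= 617 / 375 - 2 / (2 * N%:R + 1) :> R.
  by apply: le_trans h _; rewrite gerBl divr_ge0 // addr_ge0 // mulr_ge0.
elim: N N6 => // N IH; rewrite leq_eqVlt => /predU1P[<-|N6].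
  rewrite unlock /= !(natpow_neg_nat _ 2) (_ : 2 * 6%:R + 1 = 13); [lra|ring].
rewrite big_nat_recr //=; apply: le_trans (lerD (IH N6) (lexx _)) _.
rewrite (natpow_neg_nat _ 2) -[N.+1]addn1 natrD.
have : 0 <= N%:R :> R by [].
set x := N%:R => x0.
have h1 : 0 < 2 * x + 1 by lra.
have h2 : 0 < 2 * (x + 1) + 1 by lra.
have h : (x + 1) ^- 2 <= 4 / ((2 * x + 1) * (2 * (x + 1) + 1)).
  rewrite ler_pdivlMr ?mulr_gt0 // mulrC ler_pdivrMr ?exprn_gt0 //; last by lra.
  by nra.
have : 4 / ((2 * x + 1) * (2 * (x + 1) + 1)) = 2 / (2 * x + 1) - 2 / (2 * (x + 1) + 1).
  by field; rewrite !gt_eqF.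
lra.
Qed.

Lemma zeta4_ge : 4327 / 4000 <= zeta (2 * 2) :> R.
Proof.
have h4 : 2 * 2 = 4%:R :> R by lra.
apply: le_trans (_ : \sum_(1 <= n < 9) n%:R `^ (- (2 * 2)) <= _); last by apply: zeta_sum_le;
  lra.
rewrite unlock /= h4 !(natpow_neg_nat _ 4) -!exprVn; lra.
Qed.

(** Induction from [(1 + x) (1 - x - S) <= 1 - S]. When the sum is below 1, this bounds the product
    from above. *)
Lemma prime_prod_sum_le1 r (a b : nat) :
  prime_prod r a b * (1 - \sum_(a <= q < b | prime q) q%:R `^ (- r)) <= 1.
Proof.
rewrite /prime_prod.
suff : 0 <= \sum_(a <= q < b | prime q) q%:R `^ (- r) /\ 0 <= prime_prod r a b /\
  prime_prod r a b * (1 - \sum_(a <= q < b | prime q) q%:R `^ (- r)) <= 1 by case=> _ [].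
rewrite /prime_prod; elim/big_rec2: _ => [|q S P _ [S0 [P0 SP]]]; first by rewrite subr0 mulr1.
have x0 := powR_ge0 q%:R (- r); set x := _ `^ _ in x0 *.
split; first exact: addr_ge0.
split; first by rewrite mulr_ge0 // addr_ge0.
apply: le_trans SP; have : 0 <= P * x * (x + S) by rewrite !mulr_ge0 ?addr_ge0.
lra.
Qed.
(* The sum is at most [P - 1], where [P], the product of [1 + q^-2], is bounded by
   [zeta 2 / zeta 4] divided by the factors at 2, 3, 5, 7. *)
Lemma prime_inv_square_sum_le M :
  \sum_(11 <= q < M | prime q) q%:R ^- 2 <= 4 / 125 :> R.
Proof.
have F0 (q : nat) : 0 <= q%:R ^- 2 :> R by rewrite invr_ge0 exprn_ge0.
have [M11|/ltnW M11] := leqP 11 M; last by rewrite big_geq //; lra.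
have h := @prime_prod_ge_sum R 2 11 M.
under eq_bigr do rewrite -natpow_neg_nat.
(* The bounds on [zeta 2] and [zeta 4] give about 1.0319, just below [129/125 = 1.032]. *)
suff : prime_prod 2 11 M <= 129 / 125 :> R by lra.
have := @prime_prod_le_zeta R 2 M ltac:(lra).
rewrite prime_prod_four // ler_pdivlMr; last by apply: zeta_gt0; lra.
rewrite /four_primes !(natpow_neg_nat _ 2) -!exprVn.
have := zeta2_le; have := zeta4_ge.
have := @prime_prod_ge1 R 2 11 M.
move: (prime_prod 2 11 M) (zeta 2) (zeta (2 * 2)) => P z z4 P1 h4 h2 hP.
nra.
Qed.

(* With [y = 3^-r]: bounds the product over the primes [q >= 5] for [r >= 2], using
   [q^-r <= y (3 / q)^2]. *)
Definition tail_bound (y : R) := (1 + 9 / 25 * y) * (1 + 9 / 49 * y) / (1 - 36 / 125 * y).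

(** To first order in [y] this is [9/25 + 9/49 + 36/125 < 1]; the higher terms are absorbed using
    [y <= 1/9]. *)
Lemma tail_bound_lt (y : R) : 0 < y <= 9^-1 -> tail_bound y < gap_ratio y.
Proof.
move=> /andP[y0 y9]; rewrite /tail_bound /gap_ratio ltr_pdivrMr; last by lra.
rewrite [ltRHS]mulrAC ltr_pdivlMr ?ltr_wpDr ?sqr_ge0 //.
have : 0 <= y * (9^-1 - y) by rewrite mulr_ge0 ?subr_ge0 // ltW.
have : 0 <= y ^+ 2 * (9^-1 - y) by rewrite mulr_ge0 ?subr_ge0 ?sqr_ge0.
have : 0 <= y ^+ 3 * (9^-1 - y) by rewrite mulr_ge0 ?subr_ge0 ?exprn_ge0 // ltW.
lra.
Qed.

(** The factors at 5 and 7 are bounded singly. The primes from 11 on give at most [1 / (1 - S)] with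
    [S <= 9 y (4/125)]. *)
Lemma prime_prod_tail_bound r M : 2 <= r -> prime_prod r 4 M <= tail_bound (3 `^ (- r)).
Proof.
move=> r2; set y := 3 `^ (- r).
have y0 : 0 < y by exact: powR_gt0.
have y9 : y <= 9^-1.
  apply: (@le_trans _ _ (3 `^ (- 2%:R))); first by rewrite ler_powR ?ler1n //; lra.
  by rewrite powR_invn // -natrX.
apply: le_trans (prime_prod_le r 4 (leq_maxl M 11)) _.
set N := maxn M 11; have N11 : (11 <= N)%N by exact: leq_maxr.
rewrite (@prime_prod_cat _ r 4 11 N) //
  (_ : prime_prod r 4 11 = (1 + 5 `^ (- r)) * (1 + 7 `^ (- r))); last first.
  by rewrite /prime_prod unlock /= mulr1.
have h5 := @natpow_ratio_le R r 3 5 r2 isT.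
have h7 := @natpow_ratio_le R r 3 7 r2 isT.
rewrite -/y in h5 h7.
have S : \sum_(11 <= q < N | prime q) q%:R `^ (- r) <= 36 / 125 * y.
  apply: (@le_trans _ _ (9 * y * \sum_(11 <= q < N | prime q) q%:R ^- 2)); last first.
    by have := ler_wpM2l (_ : 0 <= 9 * y) (prime_inv_square_sum_le N); lra.
  rewrite mulr_sumr big_nat_cond [leRHS]big_nat_cond; apply: ler_sum => q /andP[/andP[q11 _] _].
  apply: le_trans (@natpow_ratio_le R r 3 q r2 _) _; first by rewrite (leq_trans _ q11).
  by rewrite -/y expr_div_n le_eqVlt; apply/orP; left; apply/eqP; ring.
have P1 := prime_prod_ge1 r 11 N.
have P2 := prime_prod_sum_le1 r 11 N.
rewrite /tail_bound ler_pdivlMr; last by lra.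
rewrite -[leLHS]mulrA -[leRHS]mulr1; apply: ler_pM.
- by rewrite mulr_ge0 ?addr_ge0 ?powR_ge0 ?ler01.
- by rewrite mulr_ge0 //; lra.
- apply: ler_pM; rewrite ?addr_ge0 ?powR_ge0 // lerD2l; lra.
- apply: le_trans P2; rewrite ler_pM2l; lra.
Qed.

Lemma zeta_ratio_lt_large r : 2 <= r -> zeta_ratio r < eta_lhs r.
Proof.
move=> r2; have y0 : 0 < 3 `^ (- r) :> R by exact: powR_gt0.
have y9 : 3 `^ (- r) <= 9^-1 :> R.
  apply: (@le_trans _ _ (3 `^ (- 2%:R))); first by rewrite ler_powR ?ler1n //; lra.
  by rewrite powR_invn // -natrX.
have xy0 : 0 < (1 + 2 `^ (- r)) * (1 + 3 `^ (- r)) :> R.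
  by rewrite mulr_gt0 // ltr_wpDr ?powR_ge0.
apply: (@le_lt_trans _ _ ((1 + 2 `^ (- r)) * (1 + 3 `^ (- r)) * tail_bound (3 `^ (- r)))).
  apply: zeta_ratio_le => [|M]; first by lra.
  apply: le_trans (prime_prod_le r 0 (leq_maxl M 4)) _.
  by rewrite prime_prod_three ?leq_maxr // ler_pM2l // prime_prod_tail_bound.
by rewrite /eta_lhs ltr_pM2l // tail_bound_lt // y0.
Qed.

(** After cancelling the factors at 2 and 3, [gap_ratio (1/3) = 6/5] is beaten by
    [(1 + 1/8) (1 + 1/12)]; here [5^5 <= 8^4] and [7^5 <= 12^4] bound the powers at 5 and 7. *)
Lemma eta_lhs_lt_small : eta_lhs (5 / 4 : R) < zeta_ratio (5 / 4).
Proof.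
set r : R := 5 / 4; have r1 : 1 < r by rewrite /r; lra.
apply: lt_le_trans (prime_prod_le_zeta 11 r1).
rewrite prime_prod_four // /prime_prod big_geq // mulr1 /eta_lhs /four_primes.
have y0 := powR_ge0 3 (- r) : 0 <= _ :> R; have y3 := @natpow_le_inv R r 3 (ltW r1) isT.
rewrite ltr_pM2l; last by rewrite mulr_gt0 // ltr_wpDr ?powR_ge0.
have g : gap_ratio (3 `^ (- r)) <= 6 / 5 :> R.
  apply: le_trans (@gap_ratio_le R 3^-1 _ _ _) _; [by rewrite y0|lra|].
  by rewrite /gap_ratio ler_pdivrMr; lra.
have root (q m : nat) : (0 < m)%N -> (q ^ 5 <= m ^ 4)%N -> q%:R `^ r <= m%:R :> R.
  move=> m0 qm; rewrite /r powRrM (powR_mulrn 5) ?ler0n //.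
  have -> : m%:R = (m%:R ^+ 4) `^ 4^-1 :> R.
    by rewrite -powR_mulrn ?ler0n // -powRrM divff ?powRr1 ?ler0n // pnatr_eq0.
  by apply: ge0_ler_powR; rewrite ?nnegrE ?exprn_ge0 ?ler0n // -!natrX ler_nat.
have low (q m : nat) : (0 < q)%N -> (0 < m)%N -> (q ^ 5 <= m ^ 4)%N ->
  m%:R^-1 <= q%:R `^ (- r) :> R.
  move=> q0 m0 qm; rewrite powRN lef_pV2 ?posrE ?powR_gt0 ?ltr0n //; exact: root.
have h5 := low 5 8 isT isT isT.
have h7 : 12^-1 <= 7 `^ (- r) by apply: (low 7 12).
nra.
Qed.

End ZetaRatioBounds.

(** * Existence and uniqueness of the solution, and the equivalence *)

Theorem theorem1p1 (R : realType) :
  (exists! eta : R, 1 < eta <= 2 /\ eta_star_equation eta) /\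
  (forall eta : R, 1 < eta <= 2 -> eta_star_equation eta ->
   forall r : R,
     connected (closure (unitary_sigma_range (- r))) <-> 0 < r <= eta).
Proof.
split.
  have itv : 5 / 4 <= 2 :> R by lra.
  pose F (s : R) := zeta_ratio s - eta_lhs s.
  have cF : {within `[(5 / 4 : R), 2], continuous F}.
    apply: continuous_in_subspaceT => s; rewrite inE /= in_itv /= => /andP[s1 _].
    have s1' : 1 < s by lra.
    by apply: cvgB; [exact: continuous_zeta_ratio|exact: continuous_eta_lhs].
  have F1 : 0 < F (5 / 4) by rewrite subr_gt0 eta_lhs_lt_small.
  have F2 : F 2 < 0 by rewrite subr_lt0 zeta_ratio_lt_large.
  have [|eta] := @IVT R F (5 / 4) 2 0 itv cF.
    by rewrite ge_min le_max (ltW F1) (ltW F2) orbT.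
  rewrite in_itv /= => /andP[e1 e2] /eqP; rewrite subr_eq0 => /eqP e.
  exists eta; split; first by rewrite eta_star_equationE e e2; split=> //; apply/andP;
    split=> //; lra.
  move=> eta' [/andP[e1' e2'] /eta_star_equationE e'].
  have e1lt : 1 < eta by lra.
  (* At two distinct solutions the strict inequality of [zeta_ratio_crossing] would have equal
     sides. *)
  have [lt|lt|//] := ltgtP eta eta'.
    by have := zeta_ratio_crossing e1lt lt e2'; rewrite e e' mulrC ltxx.
  by have := zeta_ratio_crossing e1' lt e2; rewrite e e' mulrC ltxx.
move=> eta /andP[e1 e2] /eta_star_equationE e r.
have xy0 : 0 < (1 + 2 `^ (- r)) * (1 + 3 `^ (- r)) :> R.
  by rewrite mulr_gt0 // ltr_wpDr ?powR_ge0.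
have L := eta_lhs_gt0 eta.
split=> [con|/andP[r0 re]]; last first.
  have [r1|r1] := lerP r 1; first by apply: connected_small; rewrite r0.
  have le_lhs : eta_lhs r <= zeta_ratio r.
    have [->|re'] := eqVneq r eta; first by rewrite e.
    have lt : r < eta by rewrite lt_neqAle re'.
    by have := zeta_ratio_crossing r1 lt e2; rewrite -e mulrC ltr_pM2r // => /ltW.
  apply: connected_of_gap3; first by rewrite r0; lra.
  move=> d d0; have [M hM] := prime_prod_near_zeta r1 d0; exists (maxn M 4).
  (* Multiplying the condition at 3 by the factors at 2 and 3 turns its left side into
     [eta_lhs r]. *)
  rewrite -(ltr_pM2l xy0); apply: le_lt_trans le_lhs _; apply: lt_le_trans hM _.
  rewrite [leRHS]mulrCA -prime_prod_three ?leq_maxr // ler_pM2l ?addr_gt0 //.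
  exact: prime_prod_le (leq_maxl _ _).
rewrite ltNge; case: lerP => [/not_connected_nonpos//|r0] /=.
rewrite leNgt; apply/negP => er; have r1 : 1 < r by lra.
have lt_lhs : zeta_ratio r < eta_lhs r.
  have [r2|r2] := lerP r 2; last by apply: zeta_ratio_lt_large; exact: ltW.
  by have := zeta_ratio_crossing e1 er r2; rewrite -e mulrC ltr_pM2l.
(* The bound [c] is the full product over the primes from 5 on. *)
apply: (@not_connected_gap R r (zeta_ratio r / ((1 + 2 `^ (- r)) * (1 + 3 `^ (- r))))) con;
  first exact: ltW.
  move=> M; rewrite ler_pdivlMr // mulrC; apply: le_trans (prime_prod_le_zeta (maxn M 4) r1).
  rewrite prime_prod_three ?leq_maxr // ler_pM2l //; exact: prime_prod_le (leq_maxl _ _).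
by rewrite ltr_pdivrMr // mulrC.
Qed.
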